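(* Let $G=1+\mathcal{A}$ be an amenable countable discrete algebra group associated with a nil $\Bbbk$-algebra $\mathcal{A}$, and let $\Gamma=G\times G$. Then, for every $\vartheta\in\mathcal{A}^{\circ}$, there is at least one ergodic measure $\mu\in\mathcal{M}_{\Gamma}^{+}(\mathcal{A}^{\circ})$ such that $\mathrm{supp}(\mu)=\mathcal{O}^{\vartheta}$, where $\mathcal{O}^{\vartheta}=\overline{\Gamma\cdot\vartheta}$ is the closure in $\mathcal{A}^{\circ}$ of the $\Gamma$-orbit of $\vartheta$.
   Context: Let $\Bbbk$ be a countable discrete field and $\mathcal{A}$ a countable associative nil $\Bbbk$-algebra (every element is nilpotent; $\mathcal{A}$ need not be finite-dimensional). The algebra group $G=1+\mathcal{A}$ is the set of formal objects $1+a$ ($a\in\mathcal{A}$) with multiplication $(1+a)(1+b)=1+a+b+ab$, equipped with the discrete topology. $\mathcal{A}^{\circ}$ is the Pontryagin dual of the additive group of $\mathcal{A}$ (all unitary characters), with the topology of pointwise convergence (a compact abelian group). The group $\Gamma=G\times G$ acts on $\mathcal{A}^{\circ}$ by $((g,h)\cdot\vartheta)(a)=\vartheta(g^{-1}ah)$. A discrete countable group $G$ is amenable if it admits a Følner sequence, i.e. a family $\{F_n\}_{n\in\mathbb{N}}$ of finite subsets of $G$ such that $\lim_{n\to\infty}|F_n\bigtriangleup(gF_n)|/|F_n|=0$ for every $g\in G$. $\mathcal{M}^{+}_{\Gamma}(\mathcal{A}^{\circ})$ is the set of $\Gamma$-invariant regular Borel probability measures on $\mathcal{A}^{\circ}$.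 Such a $\mu$ is ergodic if $\mu(B)\in\{0,1\}$ for every $\Gamma$-invariant Borel set $B$. The support $\mathrm{supp}(\mu)$ is the set of all $\vartheta\in\mathcal{A}^\circ$ such that $\mu(U)>0$ for every open neighbourhood $U$ of $\vartheta$. *)

(* Defs.v *)
From HB Require Import structures.
From mathcomp Require Import all_boot all_order all_algebra finmap complex.
From mathcomp Require Import all_classical all_reals all_analysis.

Set Implicit Arguments.
Unset Strict Implicit.
Unset Printing Implicit Defensive.

Import Order.TTheory GRing.Theory Num.Theory numFieldNormedType.Exports.

Local Open Scope classical_set_scope.
Local Open Scope ring_scope.

(* MathComp's algebras are unital, and a nonzero nil algebra never is, so
   associative algebras without unit are introduced here. *)
HB.mixin Record isNonUnitalAlgebra (K : fieldType) A & GRing.Lmodule K A := {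
  nmul : A -> A -> A;
  nmulA : associative nmul;
  nmulDl : left_distributive nmul +%R;
  nmulDr : right_distributive nmul +%R;
  nmulZl : forall (c : K) (a b : A), nmul (c *: a) b = c *: nmul a b;
  nmulZr : forall (c : K) (a b : A), nmul a (c *: b) = c *: nmul a b
}.

#[short(type="nonUnitalAlgType")]
HB.structure Definition NonUnitalAlgebra (K : fieldType) :=
  {A of GRing.Lmodule K A & isNonUnitalAlgebra K A}.

(* [npow a n] is the power of [a] of exponent [n.+1]. *)
Definition npow (K : fieldType) (A : nonUnitalAlgType K) (a : A) (n : nat) : A :=
  iter n (nmul a) a.

HB.mixin Record isNil (K : fieldType) A & NonUnitalAlgebra K A := {
  nilpotent_elt : forall a : A, exists n : nat, npow a n == 0
}.

#[short(type="nilAlgType")]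
HB.structure Definition NilAlgebra (K : fieldType) :=
  {A of NonUnitalAlgebra K A & isNil K A}.

(* [OnePlus a] is the formal object 1 + a. *)
Record algGroup (K : fieldType) (A : nilAlgType K) : Type :=
  OnePlus { minus1 : A }.

Section AlgebraGroup.
Variables (K : fieldType) (A : nilAlgType K).
Implicit Types (a b c : A) (g h : algGroup A).

HB.instance Definition _ := [isNew for @minus1 K A].
HB.instance Definition _ := [Choice of algGroup A by <:].

Lemma nmul0r a : nmul 0 a = 0.
Proof. by apply: (addrI (nmul 0 a)); rewrite -nmulDl !addr0. Qed.

Lemma nmulr0 a : nmul a 0 = 0.
Proof. by apply: (addrI (nmul a 0)); rewrite -nmulDr !addr0. Qed.

Lemma nmulNr a b : nmul a (- b) = - nmul a b.
Proof. by apply: (addrI (nmul a b)); rewrite -nmulDr !subrr nmulr0. Qed.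

Lemma nmulNl a b : nmul (- a) b = - nmul a b.
Proof. by apply: (addrI (nmul a b)); rewrite -nmulDl !subrr nmul0r. Qed.

(* 1 + qinv a is the inverse of 1 + a: a geometric series, truncated at the
   first vanishing power of - a. *)
Definition qinv a : A :=
  \sum_(i < ex_minn (nilpotent_elt (- a))) npow (- a) i.

Lemma npowSr a n : nmul (npow a n) a = npow a n.+1.
Proof. by elim: n => //= n IH; rewrite /npow /= -nmulA; congr nmul. Qed.

Lemma qinvE a : nmul (- a) (qinv a) = qinv a + a.
Proof.
rewrite /qinv; case: ex_minnP => n /eqP an0 _.
have -> : nmul (- a) (\sum_(i < n) npow (- a) i) = \sum_(i < n) npow (- a) i.+1.
  elim: n {an0} => [|n IH]; first by rewrite !big_ord0 nmulr0.
  by rewrite !big_ord_recr /= nmulDr IH.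
apply: (addrI (npow (- a) 0)).
rewrite -(big_ord_recl n (fun i => npow (- a) i)) big_ord_recr /= an0 addr0.
by rewrite /npow /= addrCA addNr addr0.
Qed.

Lemma qinvEr a : nmul (qinv a) (- a) = qinv a + a.
Proof.
rewrite -qinvE /qinv; elim: (ex_minn _) => [|n IH].
  by rewrite !big_ord0 nmulr0 nmul0r.
by rewrite !big_ord_recr /= nmulDr nmulDl IH npowSr.
Qed.

Definition algmul g h : algGroup A :=
  OnePlus (minus1 g + minus1 h + nmul (minus1 g) (minus1 h)).
Definition algone : algGroup A := OnePlus 0.
Definition alginv g : algGroup A := OnePlus (qinv (minus1 g)).

Lemma algmulA : associative algmul.
Proof.
move=> [a] [b] [c]; congr OnePlus; rewrite /= !nmulDl !nmulDr nmulA !addrA.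
by rewrite [RHS](ACl (1 * 2 * 4 * 6 * 3 * 5 * 7)).
Qed.

Lemma algmul1g : left_id algone algmul.
Proof. by move=> [a]; rewrite /algmul /= nmul0r add0r addr0. Qed.

Lemma algmulg1 : right_id algone algmul.
Proof. by move=> [a]; rewrite /algmul /= nmulr0 !addr0. Qed.

Lemma algmulVg : left_inverse algone alginv algmul.
Proof.
move=> [a]; congr OnePlus => /=.
by rewrite -[nmul _ _]opprK -nmulNr qinvEr subrr.
Qed.

Lemma algmulgV : right_inverse algone alginv algmul.
Proof.
move=> [a]; congr OnePlus => /=.
by rewrite -[nmul _ _]opprK -nmulNl qinvE [a + _]addrC subrr.
Qed.

HB.instance Definition _ := isGroup.Build (algGroup A)
  algmulA algmul1g algmulg1 algmulVg algmulgV.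

(* The products g a and a g in K + A, for g in 1 + A and a in A. *)
Definition lact g a : A := a + nmul (minus1 g) a.
Definition ract a g : A := a + nmul a (minus1 g).

Lemma lactD g : {morph lact g : a b / a + b}.
Proof. by move=> a b; rewrite /lact nmulDr addrACA. Qed.

Lemma ractD g : {morph ract^~ g : a b / a + b}.
Proof. by move=> a b; rewrite /ract nmulDl addrACA. Qed.

End AlgebraGroup.

Definition amenable (R : realType) (G : groupType) : Prop :=
  exists F : nat -> {fset G},
    (forall n, F n != fset0) /\
    forall g : G,
      (fun n => let gF := [fset (g * x)%g | x in F n]%fset in
        (#|` ((F n `\` gF) `|` (gF `\` F n))%fset|)%:R / (#|` F n|)%:R : R)
        @ \oo --> (0 : R).

(* Unitary characters of the discrete additive group A. *)
Record character (R : realType) (A : zmodType) : Type := Character {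
  chi :> A -> R[i];
  chiD : forall a b, chi (a + b) = chi a * chi b;
  chi_norm1 : forall a, `|chi a| = 1
}.

Section Dual.
Variables (R : realType) (A : zmodType).

HB.instance Definition _ := gen_eqMixin (character R A).
HB.instance Definition _ := gen_choiceMixin (character R A).

(* R[i]^o is R[i] with the topology of its norm. *)
HB.instance Definition _ := Topological.copy (character R A)
  (initial_topology (@chi R A : character R A -> {ptws A -> R[i]^o})).

Fact chi1D (a b : A) : (1 : R[i]) = 1 * 1. Proof. by rewrite mulr1. Qed.
Fact chi1_norm1 (a : A) : `|1 : R[i]| = 1. Proof. exact: normr1. Qed.

HB.instance Definition _ := isPointed.Build (character R A)
  (Character chi1D chi1_norm1).

End Dual.

Section DualAction.
Variables (R : realType) (K : fieldType) (A : nilAlgType K).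
Implicit Types (gh : algGroup A * algGroup A) (theta : character R A).

Definition dual_act_fun gh theta (a : A) : R[i] :=
  theta (ract (lact gh.1^-1%g a) gh.2).

Fact dual_act_funD gh theta (a b : A) :
  dual_act_fun gh theta (a + b) = dual_act_fun gh theta a * dual_act_fun gh theta b.
Proof. by rewrite /dual_act_fun lactD ractD chiD. Qed.

Fact dual_act_fun_norm1 gh theta (a : A) : `|dual_act_fun gh theta a| = 1.
Proof. exact: chi_norm1. Qed.

Definition dual_act gh theta : character R A :=
  Character (dual_act_funD gh theta) (@dual_act_fun_norm1 gh theta).

End DualAction.

Definition borel (X : ptopologicalType) := g_sigma_algebraType (@open X).

Section BorelMeasures.
Variables (R : realType) (X : ptopologicalType).
Implicit Type mu : probability (borel X) R.

Definition regular_measure mu : Prop :=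
  forall B : set (borel X), measurable B ->
    mu B = ereal_inf [set mu U | U in [set U : set X | open U /\ B `<=` U]] /\
    mu B = ereal_sup [set mu C | C in [set C : set X | [/\ compact C, measurable (C : set (borel X)) & C `<=` B]]].

Definition msupport mu : set X :=
  [set x | forall U : set X, open U -> U x -> (0 < mu U)%E].

Variables (S : Type) (act : S -> X -> X).

Definition invariant_measure mu : Prop :=
  forall s (B : set (borel X)), measurable B -> mu (act s @` B) = mu B.

Definition ergodic_measure mu : Prop :=
  forall B : set (borel X), measurable B -> (forall s, act s @` B = B) ->
    mu B = 0%E \/ mu B = 1%E.

Definition act_orbit (x : X) : set X := [set act s x | s in [set: S]].

End BorelMeasures.

(* Main.v *)
Require Import Defs.
From HB Require Import structures.
From mathcomp Require Import all_boot all_order all_algebra finmap complex.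
From mathcomp Require Import all_classical all_reals all_analysis.
From mathcomp Require Import measurable_realfun ring lra.

Set Implicit Arguments.
Unset Strict Implicit.
Unset Printing Implicit Defensive.

Import Order.TTheory GRing.Theory Num.Theory numFieldNormedType.Exports.

Local Open Scope classical_set_scope.
Local Open Scope ring_scope.

(* Fix one side, say the left one, and a character w. The closure of the orbit
   { v : v(a) = w(a + xa), x in A } is a coset, and its Haar probability has the
   Fourier coefficient w(a) if a lies in the kernel { a : w(Aa) = 1 } and 0
   otherwise. To construct it, apply an invariant mean of the abelian group
   (A, +) to x |-> f(v) and represent the resulting functional by a measure.

   It is ergodic. Let B be invariant and let c(a) be the integral of v(a) over B.
   As A is nil, a is in the kernel as soon as a - xa is. If a is not in the kernel,
   then either c(a) is multiplied by some w(xa) <> 1 and vanishes, or infinitely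
   many translates of a are pairwise distinct modulo the kernel; these give
   orthogonal functions with the same coefficient c(a), which is 0 by Bessel's
   inequality. If a is in the kernel, then c(a) = mu(B) w(a). Hence the indicator
   of B is constant.

   For the two-sided action, average the right Haar measures of v over the left
   Haar measure of theta in v. Left translations permute the right Haar measures,
   so both levels of the average contribute a zero-one law and full support. *)

(** The obstacle is the mixed term. For both sides together the orbit of [w] consists of the
    characters a -> w(a + xa + ay + xay), and xay is not additive in the pair (x, y): a two-sided
    orbit closure need not be a coset, so no Haar probability is attached to it directly. With one
    side fixed, x -> w(xa) is a homomorphism from (A, +) to the circle, although 1 + A need not be
    commutative. Shifting a mean on (A, +) by y multiplies the coefficient at a by w(ya), and this
    kills every coefficient outside the kernel.

    The measure so obtained is a priori invariant under translations of the coset, not under the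
    action, which carries the coefficient at a to the one at a + xa. Invariance asks that a and a +
    xa lie in the kernel together, and this is where nilpotency is decisive.

    All statements about measures are reduced to Fourier coefficients: as A is countable, its dual
    has a countable base, and trigonometric polynomials decide equality of measures as well as
    measurable dependence on a parameter. *)

Section Ultralimits.
Variables (T : Type) (F : set_system T).
Hypothesis UF : UltraFilter F.

Lemma fmap_ultra (U : Type) (f : T -> U) : UltraFilter (f @ F).
Proof.
split=> [|G PG FG]; first exact: fmap_proper_filter.
rewrite eqEsubset; split=> // B GB; rewrite /fmap /=.
have [//|FnB] := in_ultra_setVsetC (f @^-1` B) UF.
have GnB : G (~` B) by apply: FG; rewrite /fmap /=.
have : G (B `&` ~` B) by exact: filterI.
by rewrite setICr => /filter_not_empty.
Qed.

(** Compactness of [[- M, M]]. It supplies limits twice: of characters, for the compactness of the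
    dual, and of averages, for the invariant mean. *)
Lemma ultra_cvg_bounded (R : realType) (u : T -> R) (M : R) :
  (forall t, `|u t| <= M) -> cvg (u @ F).
Proof.
move=> uM; have := @segment_compact R (- M) M; rewrite compact_ultra.
move=> /(_ (u @ F) (fmap_ultra u)) [].
  apply: (@filterS _ F _ setT) => [t _|]; last exact: filterT.
  by rewrite /= in_itv /= -ler_norml.
by move=> l [_ ul]; apply/cvg_ex; exists l.
Qed.

End Ultralimits.

Lemma countable_enumeration (T : pointedType) : countable [set: T] ->
  exists e : nat -> T, forall a, exists n, e n = a.
Proof.
move=> /countable_injP[f fi].
exists (fun n => xget point [set a | f a = n]) => a; exists (f a).
have : [set b | f b = f a] (xget point [set b | f b = f a]) by apply: (@xgetPex _ point); exists a.
by move=> /fi; apply; rewrite inE.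
Qed.

(** * The dual group *)

Section CharacterTopology.
Variables (R : realType) (A : zmodType).
Local Notation X := (character R A).
Implicit Types (w : X) (z : R[i]) (a : A).

(** The complex weight [z] lets one family of real functions carry both parts of [w a] ([z = 1] and
    [z = - 'i]), so that all integrals are real; multiplying the value at [a] by a constant is
    absorbed by [z]. *)
Definition trig z a w : R := complex.Re (z * w a).

Lemma character_eq w w' : (forall a, w a = w' a) -> w = w'.
Proof.
case: w w' => [f fD f1] [g gD g1] /= fg.
have {}fg : f = g by apply/funext.
by subst g; congr Character; exact: Prop_irrelevance.
Qed.

Lemma Re_le_norm (x : R[i]) : (`|complex.Re x|%:C)%C <= `|x|.
Proof. exact: normc_ge_Re. Qed.

Lemma chi_continuous a : continuous (fun w : X => w a : R[i]^o).
Proof.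
move=> w.
apply: (@continuous_comp X {ptws A -> R[i]^o} _ (@chi R A : X -> {ptws A -> R[i]^o}) (fun f => f a)).
  exact: initial_continuous.
exact: proj_continuous.
Qed.

Lemma Re_mul_continuous z : continuous (fun x : R[i]^o => complex.Re (z * x) : R).
Proof.
move=> x; apply/(@cvgrPdist_lt _ _ _ (nbhs (x : R[i]^o)) (nbhs_filter _)) => e e0.
have e'0 : 0 < (e%:C)%C / (`|z| + 1) :> R[i].
  by rewrite divr_gt0 ?ltr_wpDl// ltcR.
have /(@cvgrPdist_lt _ _ _ (nbhs (x : R[i]^o)) (nbhs_filter _)) /(_ _ e'0) :
    (fun y : R[i]^o => y) @ x --> x by exact: cvg_id.
apply: filterS => y; rewrite ltr_pdivlMr ?ltr_wpDl// => H.
rewrite -ltcR; apply: le_lt_trans H.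
have -> : complex.Re (z * x) - complex.Re (z * y) = complex.Re (z * (x - y)).
  by rewrite mulrBr raddfB.
apply: (le_trans (Re_le_norm _)); rewrite normrM mulrC ler_wpM2l//.
by rewrite lerDl.
Qed.

Lemma trig_continuous z a : continuous (trig z a).
Proof.
move=> w; apply: (@continuous_comp X R[i]^o R (fun w : X => w a : R[i]^o) (fun x => complex.Re (z * x))).
  exact: chi_continuous.
exact: Re_mul_continuous.
Qed.

Lemma trig1 a w : trig 1 a w = complex.Re (w a).
Proof. by rewrite /trig mul1r. Qed.

Lemma trigNi a w : trig (- 'i%C) a w = complex.Im (w a).
Proof. by rewrite /trig; case: (w a) => x y /=; simpc. Qed.

Lemma norm_le_ReIm (x : R[i]) : `|x| <= ((`|complex.Re x| + `|complex.Im x|)%:C)%C.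
Proof.
rewrite {1}(complexE x) rmorphD/=; apply: le_trans (ler_normD _ _) _.
by rewrite normrM !normc_def /= !expr0n/= expr1n !addr0 add0r !sqrtr_sqr sqrtr1 mul1r.
Qed.

(** The weights [1] and [- 'i] control the real and imaginary parts of each value, hence pointwise
    convergence, which is the topology of the dual. *)
Lemma character_cvg (F : set_system X) w : Filter F ->
  (forall z a, trig z a @ F --> trig z a w) -> F --> w.
Proof.
move=> FF Fw B [_ [[U oU <-] Uw UB]].
apply: (@filterS _ F _ (@chi R A @^-1` U)) => //.
suff : {ptws, (@chi R A @ F) --> (chi w : {ptws A -> R[i]^o})}.
  by move=> /(_ U); apply; exact: open_nbhs_nbhs.
apply/cvg_sup => a; apply/cvg_image.
  by rewrite eqEsubset; split => // x _; exists (fun=> x).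
suff cva : (fun v : X => v a : R[i]^o) @ F --> (w a : R[i]^o).
  move=> C NC; exists ((fun f => f a) @^-1` C); first exact: cva.
  by rewrite image_preimage// eqEsubset; split => // x _; exists (fun=> x).
apply/(@cvgrPdist_lt R[i] R[i]^o) => e e0.
have e2 : 0 < complex.Re e / 2 by rewrite divr_gt0//; move: e0; rewrite ltcE => /andP[].
have /cvgrPdist_lt /(_ _ e2) H1 := Fw 1 a.
have /cvgrPdist_lt /(_ _ e2) H2 := Fw (- 'i%C) a.
rewrite near_simpl in H1; rewrite near_simpl in H2.
apply: (@filterS2 _ F _ _ _ _ _ H1 H2) => v.
rewrite !trig1 !trigNi => h1 h2.
rewrite -(RRe_real (gtr0_real e0)).
apply: (le_lt_trans (norm_le_ReIm _)); rewrite ltcR !raddfB/=.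
rewrite (splitr (complex.Re e)); exact: ltrD.
Qed.

Lemma normc1_sqr (x : R[i]) : `|x| = 1 <-> complex.Re x ^+ 2 + complex.Im x ^+ 2 = 1.
Proof.
split=> [x1|x1].
  by have := add_Re2_Im2 x; rewrite x1 expr1n => /complexI.
by rewrite normc_def x1 sqrtr1.
Qed.

Lemma trig_le z a w : `|trig z a w| <= complex.Re `|z|.
Proof.
rewrite -lecR RRe_real ?normr_real//.
by rewrite (le_trans (Re_le_norm _))// normrM chi_norm1 mulr1.
Qed.

(** Along an ultrafilter all values converge. Multiplicativity and modulus 1 are polynomial
    identities in real and imaginary parts, so the limit is again a character. *)
Lemma character_compact : compact [set: X].
Proof.
rewrite compact_ultra => F UF _.
have cvF z a : cvg (trig z a @ F) by exact: (ultra_cvg_bounded UF (trig_le z a)).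
pose u a : R := lim (trig 1 a @ F).
pose v a : R := lim (trig (- 'i%C) a @ F).
pose psi a : R[i] := (u a +i* v a)%C.
have cu a : (fun w : X => complex.Re (w a)) @ F --> u a.
  by rewrite -(funext (trig1 a)); exact: cvF.
have cv a : (fun w : X => complex.Im (w a)) @ F --> v a.
  by rewrite -(funext (trigNi a)); exact: cvF.
have psiD a b : psi (a + b) = psi a * psi b.
  apply/eqP; rewrite eq_complex /=; apply/andP; split; apply/eqP.
    apply: (cvg_unique _ (cu (a + b))) => //.
    rewrite (_ : (fun w : X => _) = (fun w =>
      complex.Re (w a) * complex.Re (w b) - complex.Im (w a) * complex.Im (w b))).
      by apply: cvgB; apply: cvgM.
    by apply/funext => w; rewrite chiD; case: (w a) (w b) => [? ?] [? ?].
  apply: (cvg_unique _ (cv (a + b))) => //.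
  rewrite (_ : (fun w : X => _) = (fun w =>
    complex.Re (w a) * complex.Im (w b) + complex.Im (w a) * complex.Re (w b))).
    by apply: cvgD; apply: cvgM.
  by apply/funext => w; rewrite chiD; case: (w a) (w b) => [? ?] [? ?].
have psi1 a : `|psi a| = 1.
  apply/normc1_sqr => /=.
  have c1 : (fun _ : X => 1 : R) @ F --> u a ^+ 2 + v a ^+ 2.
    rewrite !expr2 (_ : (fun _ => _) = (fun w : X =>
      complex.Re (w a) * complex.Re (w a) + complex.Im (w a) * complex.Im (w a))).
      by apply: cvgD; apply: cvgM.
    by apply/funext => w; rewrite -!expr2; apply/esym/normc1_sqr; exact: chi_norm1.
  by apply: (cvg_unique _ c1) => //; exact: cvg_cst.
exists (Character psiD psi1); split=> //; apply: character_cvg => z a.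
rewrite (_ : trig z a = (fun w =>
    complex.Re z * complex.Re (w a) - complex.Im z * complex.Im (w a))); last first.
  by apply/funext => w; rewrite /trig; case: z (w a) => [? ?] [? ?].
have -> : (fun w : X => complex.Re z * complex.Re (w a) - complex.Im z * complex.Im (w a)) (Character psiD psi1)
  = complex.Re z * u a - complex.Im z * v a by [].
by apply: cvgB; apply: cvgMr.
Qed.

(** Strict inequalities make these sets open, and concatenation of lists makes them a pi-system,
    ready for Dynkin's induction. *)
Definition cylinder (s : seq (R[i] * A * R)) : set X :=
  [set w | all (fun p => p.2 < trig p.1.1 p.1.2 w) s].

Lemma cylinder_cat s t : cylinder (s ++ t) = cylinder s `&` cylinder t.
Proof. by apply/seteqP; split=> w; rewrite /cylinder /= all_cat => /andP. Qed.

Lemma cylinder_open s : open (cylinder s).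
Proof.
elim: s => [|p s IH].
  rewrite (_ : cylinder [::] = setT); first exact: openT.
  by apply/seteqP; split.
rewrite -cat1s cylinder_cat; apply: openI => //.
rewrite (_ : cylinder _ = trig p.1.1 p.1.2 @^-1` [set x | p.2 < x]).
  by apply: open_comp => [w _|]; [exact: trig_continuous|exact: open_gt].
by apply/seteqP; split=> w; rewrite /cylinder /= andbT.
Qed.

(* The two Booleans encode a sign and a factor [- i], so that the conditions bound
   [Re (w a)] and [Im (w a)] from above and below by rationals. *)
Definition rational_cond (e : nat -> A) (t : nat * bool * bool * rat) : R[i] * A * R :=
  ((-1) ^+ t.1.1.2 * (- 'i%C) ^+ t.1.2, e t.1.1.1, ratr t.2).

Definition rational_cylinder e s := cylinder (map (rational_cond e) s).

Lemma rational_cylinder_nbhs (e : nat -> A) (U : set X) w :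
  (forall a, exists n, e n = a) -> open U -> U w ->
  exists2 s, rational_cylinder e s w & rational_cylinder e s `<=` U.
Proof.
move=> eA oU Uw.
(* It suffices that the filter generated by the rational cylinders around [w] converges to [w]: then
   one of them lies in [U]. *)
pose F := filter_from [set s | rational_cylinder e s w] (rational_cylinder e).
have FF : Filter F.
  apply: filter_from_filter; first by exists [::].
  move=> s t sw tw; exists (s ++ t).
    by rewrite /rational_cylinder /= map_cat cylinder_cat.
  by rewrite /rational_cylinder map_cat cylinder_cat.
have Fgt n b q : (let c := rational_cond e (n, false, b, q) in
    c.2 < trig c.1.1 c.1.2 w -> \forall v \near F, c.2 < trig c.1.1 c.1.2 v).
  move=> c cw; exists [:: (n, false, b, q)]; first by rewrite /= /rational_cylinder /cylinder /= andbT.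
  by move=> v; rewrite /= /rational_cylinder /cylinder /= andbT.
have Flt n b q : (let c := rational_cond e (n, false, b, q) in
    trig c.1.1 c.1.2 w < c.2 -> \forall v \near F, trig c.1.1 c.1.2 v < c.2).
  move=> c cw; exists [:: (n, true, b, - q)].
    rewrite /= /rational_cylinder /cylinder /= andbT /rational_cond /= rmorphN/=.
    by rewrite /trig expr1 mulN1r mulNr raddfN/= ltrN2; move: cw; rewrite /c /rational_cond/= mul1r.
  move=> v; rewrite /= /rational_cylinder /cylinder /= andbT /rational_cond /= rmorphN/=.
  rewrite /trig expr1 mulN1r mulNr raddfN/= ltrN2.
  by rewrite /c /rational_cond/= mul1r.
have Fc b a : trig ((- 'i%C) ^+ (b : bool)) a @ F --> trig ((- 'i%C) ^+ (b : bool)) a w.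
  have [n <-] := eA a.
  apply/cvgrPdist_lt => d d0.
  have : trig ((- 'i%C) ^+ b) (e n) w - d < trig ((- 'i%C) ^+ b) (e n) w by rewrite ltrBlDr ltrDl.
  move=> /rat_in_itvoo[p]; rewrite in_itv/= => /andP[p1 p2].
  have : trig ((- 'i%C) ^+ b) (e n) w < trig ((- 'i%C) ^+ b) (e n) w + d by rewrite ltrDl.
  move=> /rat_in_itvoo[q]; rewrite in_itv/= => /andP[q1 q2].
  have := Fgt n b p; rewrite /= mul1r => /(_ p2) H1.
  have := Flt n b q; rewrite /= mul1r => /(_ q1) H2.
  apply: (@filterS2 _ F _ _ _ _ _ H1 H2) => v h1 h2.
  rewrite ltr_distlC; apply/andP; split; lra.
have Fw : F --> w.
  apply: character_cvg => z a.
  rewrite (_ : trig z a = (fun v => complex.Re z * trig 1 a v - complex.Im z * trig (- 'i%C) a v)); last first.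
    by apply/funext => v; rewrite trig1 trigNi /trig; case: z (v a) => [? ?] [? ?].
  have := Fc false a; have := Fc true a; rewrite expr0 expr1 => h1 h2.
  by apply: cvgB; apply: cvgMr.
have [s sw sU] := Fw U (open_nbhs_nbhs (conj oU Uw)).
by exists s.
Qed.

Lemma open_rational_cylinders (e : nat -> A) (U : set X) :
  (forall a, exists n, e n = a) -> open U ->
  U = \bigcup_(s in [set s | rational_cylinder e s `<=` U]) rational_cylinder e s.
Proof.
move=> eA oU; apply/seteqP; split=> [w Uw|w [s sU sw]]; last exact: sU.
by have [s sw sU] := rational_cylinder_nbhs eA oU Uw; exists s.
Qed.

(** Rational cylinders are indexed by lists over a countable type, so an open set is a countable
    union of cylinders. *)
Lemma borel_cylinderE : countable [set: A] ->
  @measurable _ (borel X) = <<s range cylinder >>.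
Proof.
move=> cA; have [e eA] := countable_enumeration cA.
apply/seteqP; split; apply: smallest_sub; try exact: smallest_sigma_algebra.
  move=> U oU; rewrite (open_rational_cylinders eA oU).
  pose gT : measurableType _ := g_sigma_algebraType (range cylinder).
  rewrite bigcup_mkcond; apply: (@countable_bigcupT_measurable _ gT) => // s.
  by case: ifP => _; [apply: sub_sigma_algebra; exists (map (rational_cond e) s)|exact: measurable0].
by move=> _ [s _ <-]; apply: sub_sigma_algebra; exact: cylinder_open.
Qed.

Lemma cylinder_setI_closed : setI_closed (range cylinder).
Proof. by move=> _ _ [s _ <-] [t _ <-]; exists (s ++ t) => //; rewrite cylinder_cat. Qed.

Lemma chi0 w : w 0 = 1.
Proof.
have w0 : w 0 != 0 by rewrite -normr_eq0 chi_norm1 oner_eq0.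
by apply: (mulfI w0); rewrite -chiD addr0 mulr1.
Qed.

Lemma chiN w a : w (- a) = ((w a)^*)%C.
Proof.
have wa : w a != 0 by rewrite -normr_eq0 chi_norm1 oner_eq0.
by apply: (mulfI wa); rewrite -chiD subrr chi0 -sqr_normc chi_norm1 expr1n.
Qed.

(** Product-to-sum formula: Re p Re q is half of Re (pq) + Re (p conj q), and the conjugate of
    [w a'] is [w (- a')]. Hence trigonometric polynomials form an algebra. *)
Lemma trigM z a z' a' w : trig z a w * trig z' a' w =
  trig ((2^-1)%:C%C * z * z') (a + a') w + trig ((2^-1)%:C%C * z * (z'^*)%C) (a - a') w.
Proof.
rewrite /trig !chiD chiN.
case: z z' (w a) (w a') => [x1 x2] [y1 y2] [u1 u2] [v1 v2] /=.
by field.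
Qed.

Definition trigpoly (s : seq (R[i] * A)) w : R := \sum_(p <- s) trig p.1 p.2 w.

Definition is_trigpoly (f : X -> R) := exists s, f = trigpoly s.

Lemma is_trigpoly_trig z a : is_trigpoly (trig z a).
Proof. by exists [:: (z, a)]; apply/funext => w; rewrite /trigpoly big_seq1. Qed.

Lemma trigC (c : R) w : trig c%:C%C 0 w = c.
Proof. by rewrite /trig chi0 mulr1. Qed.

Lemma is_trigpolyC (c : R) : is_trigpoly (fun=> c).
Proof. by exists [:: (c%:C%C, 0)]; apply/funext => w; rewrite /trigpoly big_seq1 trigC. Qed.

Lemma is_trigpolyD f g : is_trigpoly f -> is_trigpoly g -> is_trigpoly (fun w => f w + g w).
Proof.
by move=> [s ->] [t ->]; exists (s ++ t); apply/funext => w; rewrite /trigpoly big_cat.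
Qed.

Lemma is_trigpoly_sum I (s : seq I) (F : I -> X -> R) :
  (forall i, is_trigpoly (F i)) -> is_trigpoly (fun w => \sum_(i <- s) F i w).
Proof.
move=> tF; elim: s => [|i s IH].
  rewrite (_ : (fun w => _) = fun=> 0); first exact: is_trigpolyC.
  by apply/funext => w; rewrite big_nil.
rewrite (_ : (fun w => _) = fun w => F i w + \sum_(i <- s) F i w).
  exact: is_trigpolyD.
by apply/funext => w; rewrite big_cons.
Qed.

Lemma is_trigpolyM f g : is_trigpoly f -> is_trigpoly g -> is_trigpoly (fun w => f w * g w).
Proof.
move=> [s ->] [t ->].
rewrite (_ : (fun w => _) = fun w =>
    \sum_(p <- s) \sum_(q <- t) trig p.1 p.2 w * trig q.1 q.2 w); last first.
  apply/funext => w; rewrite /trigpoly big_distrl/=; apply: eq_bigr => p _.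
  by rewrite big_distrr.
apply: is_trigpoly_sum => p; apply: is_trigpoly_sum => q.
rewrite (funext (trigM _ _ _ _)).
by apply: is_trigpolyD; exact: is_trigpoly_trig.
Qed.

Lemma is_trigpolyX f n : is_trigpoly f -> is_trigpoly (fun w => f w ^+ n).
Proof.
move=> tf; elim: n => [|n IH]; first exact: (is_trigpolyC 1).
rewrite (_ : (fun w => _) = fun w => f w * f w ^+ n); first exact: is_trigpolyM.
by apply/funext => w; rewrite exprS.
Qed.

Lemma trigpoly_continuous s : continuous (trigpoly s).
Proof.
elim: s => [|p s IH].
  rewrite (_ : trigpoly _ = cst 0); first exact: cst_continuous.
  by apply/funext => w; rewrite /trigpoly big_nil.
rewrite (_ : trigpoly _ = trig p.1 p.2 \+ trigpoly s); last first.
  by apply/funext => w; rewrite /trigpoly big_cons.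
by move=> w; exact: (cvgD (@trig_continuous _ _ w) (IH w)).
Qed.

End CharacterTopology.

(** * Polynomials converging to a step function, and indicators of cylinders *)

Section StepPolynomials.
Variable R : realType.
Implicit Types x s : R.

Lemma bernoulli_le x n : 0 <= x <= 1 -> 1 - n%:R * x <= (1 - x) ^+ n.
Proof.
move=> /andP[x0 x1]; elim: n => [|n IH]; first by rewrite mul0r subr0 expr0.
rewrite exprS; apply: le_trans (ler_wpM2l _ IH); last by rewrite subr_ge0.
have : 0 <= n%:R * x * x by rewrite !mulr_ge0.
by rewrite -natr1; nra.
Qed.

Lemma bernoulli_ge x n : 0 <= x <= 1 -> (1 - x) ^+ n * (1 + n%:R * x) <= 1.
Proof.
move=> /andP[x0 x1]; elim: n => [|n IH]; first by rewrite mul0r addr0 mulr1 expr0.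
apply: le_trans IH; rewrite exprS [(1 - x) * _]mulrC -mulrA ler_wpM2l ?exprn_ge0 ?subr_ge0//.
have : 0 <= n%:R * x * x by rewrite !mulr_ge0.
by rewrite -natr1; nra.
Qed.

(** With y the square root of x, n x^n = (n y^n) y^n, and [bernoulli_ge] at 1 - y bounds n y^n by 1
    / (1 - y). *)
Lemma cvg_natM_exp x : 0 <= x < 1 -> (fun n => n%:R * x ^+ n) @ \oo --> (0 : R).
Proof.
move=> /andP[x0 x1].
pose y := Num.sqrt x; have y0 : 0 <= y by rewrite sqrtr_ge0.
have y1 : y < 1 by rewrite -sqrtr1 ltr_sqrt.
have xy : x = y * y by rewrite -expr2 sqr_sqrtr.
have H n : n%:R * y ^+ n <= (1 - y)^-1.
  have := @bernoulli_ge (1 - y) n; rewrite subKr => /(_ _).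
  have -> : (0 <= 1 - y <= 1) by apply/andP; split; lra.
  move=> /(_ isT); rewrite mulrDr mulr1 => le1.
  rewrite -div1r ler_pdivlMr ?subr_gt0// -mulrA mulrCA.
  by apply: le_trans le1; rewrite lerDr exprn_ge0.
apply: (@squeeze_cvgr _ _ _ _ (cst 0) (geometric (1 - y)^-1 y)).
- near=> n; rewrite mulr_ge0 ?exprn_ge0//= xy exprMn mulrA.
  by rewrite ler_wpM2r ?exprn_ge0.
- exact: cvg_cst.
- by apply: cvg_geometric; rewrite ger0_norm.
Unshelve. all: by end_near. Qed.

(* The polynomials of Brosowski and Deutsch's proof of the Stone-Weierstrass theorem. *)
Definition steppoly n s : R := (1 - ((1 - s) / 2) ^+ n) ^+ (n * 2 ^ n).

Lemma steppoly_itv n s : `|s| <= 1 -> 0 <= steppoly n s <= 1.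
Proof.
rewrite ler_norml => /andP[s0 s1].
have x0 : 0 <= ((1 - s) / 2) ^+ n <= 1 by rewrite exprn_ge0 ?exprn_ile1//; lra.
by apply/andP; split; [apply: exprn_ge0|apply: exprn_ile1]; lra.
Qed.

(** The outer exponent times the inner power is n (1 - s)^n. For s > 0 it tends to 0 and
    [bernoulli_le] pushes the value to 1; for s <= 0 it is at least n and [bernoulli_ge] bounds the
    value by 1 / (n + 1). The limit 0 at s = 0 matches the strict inequalities of cylinders. *)
Lemma steppoly_cvg s : `|s| <= 1 -> steppoly ^~ s @ \oo --> ((0 < s)%R%:R : R).
Proof.
move=> s1; have := s1; rewrite ler_norml => /andP[sN1 sle1].
have x0 n : 0 <= ((1 - s) / 2) ^+ n <= 1 by rewrite exprn_ge0 ?exprn_ile1//; lra.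
have [sgt0|sle0] := ltP 0 s.
  apply: (@squeeze_cvgr _ _ _ _ (fun n => 1 - n%:R * (1 - s) ^+ n) (cst 1)).
  - near=> n; have /andP[_ ->] := steppoly_itv n s1; rewrite andbT.
    apply: le_trans (bernoulli_le _ (x0 n)).
    by rewrite natrM natrX -mulrA -exprMn mulrCA divff ?mulr1.
  - rewrite -[X in _ --> X]subr0; apply: cvgB; first exact: cvg_cst.
    by apply: cvg_natM_exp; apply/andP; split; lra.
  - exact: cvg_cst.
apply: (@squeeze_cvgr _ _ _ _ (cst 0) harmonic).
- near=> n; have /andP[-> _] := steppoly_itv n s1 => /=.
  have := bernoulli_ge (n * 2 ^ n) (x0 n); rewrite -/(steppoly n s) => H.
  rewrite /harmonic/= -div1r ler_pdivlMr//; apply: le_trans H.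
  apply: ler_wpM2l; first by have /andP[] := steppoly_itv n s1.
  rewrite -natr1 addrC lerD2l natrM natrX -mulrA -exprMn mulrCA divff ?mulr1//.
  by rewrite ler_peMr// exprn_ege1//; lra.
- exact: cvg_cst.
- exact: cvg_harmonic.
Unshelve. all: by end_near. Qed.

End StepPolynomials.

(** Each condition contributes a factor [steppoly n] of the rescaled difference [trig z a w - c].
    The uniform bounds 0 and 1 prepare dominated convergence. *)
Lemma cylinder_approx (R : realType) (A : zmodType) (s : seq (R[i] * A * R)) :
  exists f : nat -> character R A -> R,
    [/\ forall n, is_trigpoly (f n), forall n w, 0 <= f n w <= 1 &
        forall w, f ^~ w @ \oo --> (\1_(cylinder s) w : R)].
Proof.
elim: s => [|[[z a] c] s [f [tf f01 fs]]].
  exists (fun _ _ => 1); split=> [n|n w|w]; first exact: is_trigpolyC.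
    by rewrite ler01 lexx.
  by rewrite indicE mem_set//; exact: cvg_cst.
pose M := complex.Re `|z| + `|c| + 1.
have z0 : 0 <= complex.Re `|z| by exact: le_trans (normr_ge0 _) (trig_le z a point).
have M0 : 0 < M by rewrite ltr_wpDl// addr_ge0.
pose t w := M^-1 * (trig z a w - c).
have t1 w : `|t w| <= 1.
  rewrite /t normrM gtr0_norm ?invr_gt0// mulrC ler_pdivrMr// mul1r.
  apply: (le_trans (ler_normB _ _)); have := trig_le z a w.
  by rewrite /M => ?; rewrite -addrA lerD// lerDl.
have tt : is_trigpoly t.
  apply: is_trigpolyM; first exact: is_trigpolyC.
  by apply: is_trigpolyD; [exact: is_trigpoly_trig|exact: is_trigpolyC].
exists (fun n w => steppoly n (t w) * f n w); split=> [n|n w|w].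
- apply: is_trigpolyM => //; apply: is_trigpolyX.
  rewrite (_ : (fun w => _) = (fun w => 1 + -1 * (((1 + -1 * t w) * 2^-1) ^+ n))); last first.
    by apply/funext => w; rewrite !mulN1r.
  apply: is_trigpolyD; first exact: is_trigpolyC.
  apply: is_trigpolyM; first exact: is_trigpolyC.
  apply: is_trigpolyX; apply: is_trigpolyM; last exact: is_trigpolyC.
  apply: is_trigpolyD; first exact: is_trigpolyC.
  by apply: is_trigpolyM => //; exact: is_trigpolyC.
- have /andP[? ?] := steppoly_itv n (t1 w); have /andP[? ?] := f01 n w.
  by rewrite mulr_ge0//= mulr_ile1.
- rewrite (_ : \1_ _ w = (0 < t w)%R%:R * \1_(cylinder s) w); last first.
    rewrite !indicE -natrM mulnb; congr (_%:R); congr nat_of_bool.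
    rewrite /t pmulr_rgt0 ?invr_gt0// subr_gt0.
    apply/idP/andP; rewrite ?inE /cylinder/=.
      by move/andP.
    by move=> ?; apply/andP.
  by apply: cvgM; [exact: steppoly_cvg|exact: fs].
Qed.

(** * Integration over Borel sets, and uniqueness from Fourier coefficients *)

Section BorelIntegrals.
Variables (R : realType) (X : ptopologicalType).
Implicit Type m : probability (borel X) R.

Lemma open_borel_measurable (U : set X) : open U -> measurable (U : set (borel X)).
Proof. exact: sub_sigma_algebra. Qed.

Lemma closed_borel_measurable (C : set X) : closed C -> measurable (C : set (borel X)).
Proof.
move=> cC; rewrite -[C]setCK; apply: measurableC.
by apply: open_borel_measurable; exact: closed_openC.
Qed.

Lemma borel_measurable_continuous (f : X -> R) : continuous f ->
  measurable_fun [set: borel X] (f : borel X -> R).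
Proof.
move=> /continuousP cf mD; apply: (measurability _ (RGenOpens.measurableE R)) => //.
move=> _ [_ [a [b ->] <-]]; rewrite setTI; apply: sub_sigma_algebra.
exact/cf/interval_open.
Qed.

Lemma bounded_integrable m (D : set (borel X)) (f : borel X -> R) (M : R) :
  measurable D -> measurable_fun setT f -> (forall x, `|f x| <= M) ->
  m.-integrable D (EFin \o f).
Proof.
move=> mD mf fM; apply: measurable_bounded_integrable => //.
- by rewrite (le_lt_trans (probability_le1 m mD))// ltry.
- exact: measurable_funTS.
- exists M; split; first by rewrite num_real.
  by move=> x Mx y _; exact: le_trans (fM y) (ltW Mx).
Qed.

End BorelIntegrals.

Section TrigIntegrals.
Variables (R : realType) (A : zmodType).
Local Notation X := (character R A).
Implicit Type m : probability (borel X) R.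

Lemma trig_measurable z a : measurable_fun [set: borel X] (trig z a : borel X -> R).
Proof. apply: borel_measurable_continuous; exact: trig_continuous. Qed.

Lemma trigpoly_measurable s : measurable_fun [set: borel X] (trigpoly s : borel X -> R).
Proof. apply: borel_measurable_continuous; exact: trigpoly_continuous. Qed.

Lemma trig_integrable m (D : set (borel X)) z a : measurable D ->
  m.-integrable D (EFin \o (trig z a : borel X -> R)).
Proof.
move=> mD; apply: (@bounded_integrable R _ m D _ (complex.Re `|z|)) => //.
  exact: trig_measurable.
exact: trig_le.
Qed.

Lemma trigpoly_le s : exists M : R, forall w : X, `|trigpoly s w| <= M.
Proof.
exists (\sum_(p <- s) complex.Re `|p.1|) => w; rewrite /trigpoly.
apply: (le_trans (ler_norm_sum _ _ _)); apply: ler_sum => p _; exact: trig_le.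
Qed.

Lemma trigpoly_integrable m (D : set (borel X)) s : measurable D ->
  m.-integrable D (EFin \o (trigpoly s : borel X -> R)).
Proof.
move=> mD; have [M sM] := trigpoly_le s.
apply: (@bounded_integrable R _ m D _ M) => //; exact: trigpoly_measurable.
Qed.

Lemma Rintegral_trigpoly m (D : set (borel X)) s : measurable D ->
  (\int[m]_(w in D) trigpoly s w = \sum_(p <- s) \int[m]_(w in D) trig p.1 p.2 w)%R.
Proof.
move=> mD; elim: s => [|p s IH].
  rewrite big_nil (_ : trigpoly [::] = cst 0) ?Rintegral_cst ?mul0r//.
  by apply/funext => w; rewrite /trigpoly big_nil.
rewrite big_cons -IH -RintegralD//.
- by congr Rintegral; apply/funext => w; rewrite /trigpoly big_cons.
- exact: trig_integrable.
- exact: trigpoly_integrable.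
Qed.

Lemma cylinder_measurable s : measurable (cylinder s : set (borel X)).
Proof. by apply: sub_sigma_algebra; exact: cylinder_open. Qed.

Lemma cvg_Rintegral_indic m (D : set (borel X)) (C : set (borel X)) (f : nat -> X -> R) :
  measurable D -> measurable C ->
  (forall n, is_trigpoly (f n)) -> (forall n w, 0 <= f n w <= 1) ->
  (forall w, f ^~ w @ \oo --> (\1_C w : R)) ->
  (fun n => (\int[m]_(w in D) f n w)%R) @ \oo --> fine (m (D `&` C)).
Proof.
move=> mD mC tf f01 fC.
have fin : m (D `&` C) \is a fin_num by apply: fin_num_measure; exact: measurableI.
have := @dominated_convergence _ (borel X) R m D mD (fun n => EFin \o f n) (EFin \o \1_C) (cst 1%E).
case.
- by move=> n; have [s ->] := tf n; apply/measurable_EFinP; apply: measurable_funTS; exact: trigpoly_measurable.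
- by apply/measurable_EFinP; apply: measurable_funTS; exact: measurable_indic.
- by apply: aeW => w Dw; apply/fine_cvgP => /=; split; [exact: nearW|exact: fC].
- by apply: (@bounded_integrable R _ m D (cst 1) 1) => // w; rewrite normr1.
- by apply: aeW => w n Dw /=; have /andP[f0 f1] := f01 n w; rewrite lee_fin ger0_norm.
move=> _ _; rewrite integral_indic//= setIC -[X in _ --> X]fineK// => /fine_cvgP[_].
by [].
Qed.

Lemma fine_measure_bigcup_cvg m (D : set (borel X)) (F : (set (borel X))^nat) :
  measurable D -> (forall n, measurable (F n)) -> trivIset setT F ->
  (fun n => \sum_(0 <= i < n) fine (m (D `&` F i))) @ \oo -->
    fine (m (D `&` \bigcup_i F i)).
Proof.
move=> mD mF tF.
have fin (C : set (borel X)) : measurable C -> m (D `&` C) \is a fin_num.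
  by move=> mC; apply: fin_num_measure; exact: measurableI.
have tDF : trivIset [set: nat] (fun i => D `&` F i) by exact: trivIset_setIl.
have mDF : measurable (\bigcup_i (D `&` F i)).
  by apply: bigcup_measurable => i _; exact: measurableI.
rewrite setI_bigcupr.
have := @measure_semi_sigma_additive _ _ _ m (fun i => D `&` F i) (fun i => measurableI _ _ mD (mF i)) tDF mDF.
move=> cvU.
have fU : m (\bigcup_i (D `&` F i)) \is a fin_num by exact: fin_num_measure.
have : (fun n => \sum_(0 <= i < n) m (D `&` F i))%E @ \oo -->
    (fine (m (\bigcup_i (D `&` F i))))%:E by rewrite fineK.
move=> /fine_cvgP[_]; apply: cvg_trans; apply: near_eq_cvg.
by near=> n; rewrite /= sum_fine// => i _; exact: fin.
Unshelve. all: by end_near. Qed.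

(** Cylinders are reached by dominated convergence, Borel sets by Dynkin's induction. The domains
    and the factor [c] serve the zero-one law: with [D1] an invariant set, [D2] the whole space and
    [c] the measure of [D1], it says that [D1] is independent of every Borel set. *)
Lemma trig_determines m1 m2 (D1 D2 : set (borel X)) (c : R) :
  countable [set: A] -> measurable D1 -> measurable D2 ->
  (forall z a, (\int[m1]_(w in D1) trig z a w = c * \int[m2]_(w in D2) trig z a w)%R) ->
  forall C : set (borel X), measurable C ->
    (fine (m1 (D1 `&` C)) = c * fine (m2 (D2 `&` C)))%R.
Proof.
move=> cA mD1 mD2 m12.
have tp12 s : (\int[m1]_(w in D1) trigpoly s w = c * \int[m2]_(w in D2) trigpoly s w)%R.
  by rewrite !Rintegral_trigpoly// big_distrr; apply: eq_bigr => p _; exact: m12.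
have int1 m (D : set (borel X)) : measurable D -> (\int[m]_(w in D) trig 1 0 w)%R = fine (m D).
  move=> mD; rewrite -[RHS]mul1r -Rintegral_cst//; apply: eq_Rintegral => w _.
  by rewrite trig1 chi0.
have fin m (D C : set (borel X)) : measurable D -> measurable C -> m (D `&` C) \is a fin_num.
  by move=> mD mC; apply: fin_num_measure; exact: measurableI.
move=> C; rewrite {1}(borel_cylinderE R cA); move: C.
apply: (@dynkin_induction _ (borel X) (range (@cylinder R A))).
- exact: borel_cylinderE.
- exact: cylinder_setI_closed.
- rewrite !setIT; by have := m12 1 0; rewrite !int1.
- move=> _ [s _ <-]; have [f [tf f01 fs]] := cylinder_approx s.
  have mC := cylinder_measurable s.
  have h1 := cvg_Rintegral_indic (m := m1) mD1 mC tf f01 fs.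
  apply: (cvg_unique _ h1) => //.
  rewrite (_ : (fun n => (\int[m1]_(w in D1) f n w)%R) = (fun n => c * \int[m2]_(w in D2) f n w)%R).
    by apply: cvgMr; exact: cvg_Rintegral_indic.
  by apply/funext => n; have [t ->] := tf n; exact: tp12.
- move=> C mC IH.
  have split m D : measurable D -> fine (m (D `&` ~` C)) = fine (m D) - fine (m (D `&` C)).
    move=> mD; rewrite -setDE measureD//; last by rewrite -ge0_fin_numE//; exact: fin_num_measure.
    by rewrite fineB//; [exact: fin_num_measure|exact: fin].
  rewrite !split// mulrBr -IH; congr (_ - _).
  by have := m12 1 0; rewrite !int1.
- move=> F mF tF IH.
  apply: (cvg_unique _ (@fine_measure_bigcup_cvg m1 _ _ mD1 mF tF)) => //.
  rewrite (_ : (fun n => \sum_(0 <= i < n) fine (m1 (D1 `&` F i))) =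
      (fun n => c * \sum_(0 <= i < n) fine (m2 (D2 `&` F i)))).
    by apply: cvgMr; exact: fine_measure_bigcup_cvg.
  by apply/funext => n; rewrite big_distrr; apply: eq_bigr => i _; exact: IH.
Qed.

(** The same passage from trigonometric polynomials to cylinders to Borel sets, now preserving
    measurability in [t]. It makes the right Haar measures a kernel that can be averaged. *)
Lemma kernel_measurable d (T : measurableType d) (k : T -> probability (borel X) R) :
  countable [set: A] ->
  (forall z a, measurable_fun [set: T] (fun t => \int[k t]_w trig z a w)%R) ->
  forall B : set (borel X), measurable B -> measurable_fun [set: T] (fun t => k t B).
Proof.
move=> cA mk.
have mktp s : measurable_fun [set: T] (fun t => \int[k t]_w trigpoly s w)%R.
  rewrite (_ : (fun t => _) = (fun t => \sum_(p <- s) \int[k t]_w trig p.1 p.2 w)%R).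
    exact: measurable_sum.
  by apply/funext => t; rewrite Rintegral_trigpoly.
suff H (B : set (borel X)) : measurable B -> measurable_fun [set: T] (fun t => fine (k t B)).
  move=> B mB; rewrite (_ : (fun t => k t B) = EFin \o (fun t => fine (k t B))).
    by apply/measurable_EFinP; exact: H.
  by apply/funext => t /=; rewrite fineK// fin_num_measure.
rewrite {1}(borel_cylinderE R cA); move: B.
apply: (@dynkin_induction _ (borel X) (range (@cylinder R A))).
- exact: borel_cylinderE.
- exact: cylinder_setI_closed.
- rewrite (_ : (fun t => _) = cst 1)//.
  by apply/funext => t; rewrite probability_setT.
- move=> _ [s _ <-]; have [f [tf f01 fs]] := cylinder_approx s.
  apply: (@measurable_fun_cvg _ _ _ _ (fun n t => (\int[k t]_w f n w)%R)).
    by move=> n; have [u ->] := tf n; exact: mktp.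
  move=> t _; rewrite -[X in k t X]setTI; apply: cvg_Rintegral_indic => //.
  exact: cylinder_measurable.
- move=> B mB IH; rewrite (_ : (fun t => _) = (fun t => 1 - fine (k t B))).
    exact: measurable_funB.
  by apply/funext => t; rewrite probability_setC// fineB// fin_num_measure.
- move=> F mF tF IH.
  apply: (@measurable_fun_cvg _ _ _ _ (fun n t => \sum_(0 <= i < n) fine (k t (F i)))%R).
    by move=> n; exact: measurable_sum.
  move=> t _; have := @fine_measure_bigcup_cvg (k t) _ _ measurableT mF tF.
  rewrite setTI; apply: cvg_trans; apply: near_eq_cvg; apply: nearW => n.
  by apply: eq_bigr => i _; rewrite setTI.
Qed.

End TrigIntegrals.

(** * Positive functionals on a compact space *)

Section RieszExistence.
Variables (R : realType) (X : ptopologicalType) (L : (X -> R) -> R).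
Hypothesis X_compact : compact [set: X].
Hypothesis L_linear : forall (c : R) (f g : X -> R), continuous f -> continuous g ->
  L (fun x => c * f x + g x) = c * L f + L g.
Hypothesis L_ge0 : forall f : X -> R, continuous f -> (forall x, 0 <= f x) -> 0 <= L f.
Hypothesis L1 : L (fun=> 1) = 1.

Let cstc (c : R) : continuous (fun _ : X => c). Proof. by move=> x; exact: cvg_cst. Qed.

Let L0 : L (fun=> 0) = 0.
Proof.
have := @L_linear (-1) (fun=> 0) (fun=> 0) (@cstc 0) (@cstc 0).
rewrite (_ : (fun _ : X => -1 * 0 + 0) = (fun=> 0)); last by apply/funext => x; rewrite mulr0 addr0.
by rewrite mulN1r addNr.
Qed.

Let LD (f g : X -> R) : continuous f -> continuous g -> L (fun x => f x + g x) = L f + L g.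
Proof.
move=> cf cg; have := L_linear 1 cf cg; rewrite mul1r => <-.
by congr L; apply/funext => x; rewrite mul1r.
Qed.

Let LZ c (f : X -> R) : continuous f -> L (fun x => c * f x) = c * L f.
Proof.
move=> cf; have := L_linear c cf (@cstc 0); rewrite L0 addr0 => <-.
by congr L; apply/funext => x; rewrite addr0.
Qed.

Let L_le (f g : X -> R) : continuous f -> continuous g -> (forall x, f x <= g x) -> L f <= L g.
Proof.
move=> cf cg fg; rewrite -subr_ge0 addrC -mulN1r -L_linear//; apply: L_ge0 => [|x].
  by move=> x; apply: cvgD; [apply: cvgM; [exact: cvg_cst|exact: cf]|exact: cg].
by rewrite mulN1r addrC subr_ge0.
Qed.

(** Countable subadditivity is left to [mu_ext], which takes infima of sums of capacities over
    countable covers. *)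
Definition capacity (B : set (borel X)) : \bar R :=
  ereal_inf [set (L g)%:E | g in [set g : X -> R | [/\ continuous g,
    forall x, 0 <= g x & forall x, B x -> 1 <= g x]]].

Let capacity_ge0 B : (0 <= capacity B)%E.
Proof. by apply: le_ereal_inf_tmp => _ [g [cg g0 gB] <-]; rewrite lee_fin L_ge0. Qed.

Let capacity0 : capacity set0 = 0%E.
Proof.
apply/eqP; rewrite eq_le capacity_ge0 andbT; apply: ereal_inf_lbound.
by exists (fun=> 0); rewrite ?L0//; split => // x.
Qed.

Definition riesz_outer : set (borel X) -> \bar R := mu_ext capacity.

HB.instance Definition _ := isOuterMeasure.Build R (borel X) riesz_outer
  (mu_ext0 capacity0 capacity_ge0) (mu_ext_ge0 capacity_ge0) (le_mu_ext capacity)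
  (mu_ext_sigma_subadditive capacity_ge0).
Let mu := riesz_outer.

Definition ramp (a b : R) (f : X -> R) (x : X) : R := Num.min (Num.max ((b - a)^-1 * (f x - a)) 0) 1.

Let ramp_continuous a b (f : X -> R) : continuous f -> continuous (ramp a b f).
Proof.
move=> cf x; apply: (@continuous_min _ _ (fun x => Num.max _ 0) (fun=> 1)); last exact: cvg_cst.
apply: (@continuous_max _ _ (fun x => (b - a)^-1 * (f x - a)) (fun=> 0)); last exact: cvg_cst.
by apply: cvgM; [exact: cvg_cst|apply: cvgB; [exact: cf|exact: cvg_cst]].
Qed.

Let ramp_itv a b f x : 0 <= ramp a b f x <= 1.
Proof.
by rewrite /ramp le_min le_max lexx orbT ler01 ge_min lexx orbT.
Qed.

Let ramp_ge a b f x : a < b -> b <= f x -> ramp a b f x = 1.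
Proof.
move=> ab bf; rewrite /ramp; apply/min_idPr; rewrite le_max mulrC ler_pdivlMr ?subr_gt0//.
by rewrite mul1r lerD2r bf.
Qed.

Let ramp_le a b f x : a < b -> f x <= a -> ramp a b f x = 0.
Proof.
move=> ab fa; rewrite /ramp; have -> : Num.max ((b - a)^-1 * (f x - a)) 0 = 0.
  by apply/max_idPr; rewrite mulr_ge0_le0 ?invr_ge0 ?subr_ge0 ?subr_le0// ltW.
by apply/min_idPl.
Qed.

Let ge_measurable (f : X -> R) a : continuous f -> measurable ([set x | a <= f x] : set (borel X)).
Proof.
move=> cf; rewrite (_ : [set x | _] = setT `&` f @^-1` `[a, +oo[%classic).
  by apply: (borel_measurable_continuous cf).
by apply/seteqP; split=> x; rewrite /= in_itv/= andbT; [split|case].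
Qed.

Let le_measurable (f : X -> R) a : continuous f -> measurable ([set x | f x <= a] : set (borel X)).
Proof.
move=> cf; rewrite (_ : [set x | _] = setT `&` f @^-1` `]-oo, a]%classic).
  by apply: (borel_measurable_continuous cf).
by apply/seteqP; split=> x; rewrite /= in_itv/=; [split|case].
Qed.

(** The ramp [p] is 1 where [b <= f] and 0 where [f <= a], so [g * p] and [g * (1 - p)] are
    admissible for the two pieces and add up to [g]. *)
Let capacity_separated (f : X -> R) (a b : R) (B : set (borel X)) : continuous f -> a < b ->
  (capacity (B `&` [set x | (b <= f x)%R]) + capacity (B `&` [set x | (f x <= a)%R]) <= capacity B)%E.
Proof.
move=> cf ab; apply: le_ereal_inf_tmp => _ [g [cg g0 gB] <-].
pose p := ramp a b f; have cp : continuous p by exact: ramp_continuous.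
have cgp : continuous (fun x => g x * p x) by move=> x; apply: cvgM; [exact: cg|exact: cp].
have cgq : continuous (fun x => g x * (1 - p x)).
  by move=> x; apply: cvgM; [exact: cg|apply: cvgB; [exact: cvg_cst|exact: cp]].
have -> : L g = L (fun x => g x * p x) + L (fun x => g x * (1 - p x)).
  by rewrite -LD//; congr L; apply/funext => x; rewrite -mulrDr addrCA subrr addr0 mulr1.
rewrite EFinD; apply: leeD; apply: ereal_inf_lbound.
  exists (fun x => g x * p x) => //; split => // x.
    by have /andP[? _] := ramp_itv a b f x; rewrite mulr_ge0.
  by move=> [Bx bf]; rewrite /p ramp_ge// mulr1 gB.
exists (fun x => g x * (1 - p x)) => //; split => // x.
  by have /andP[_ ?] := ramp_itv a b f x; rewrite mulr_ge0// subr_ge0.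
by move=> [Bx fa]; rewrite /p ramp_le// subr0 mulr1 gB.
Qed.

(** The analogue of additivity of a metric outer measure on sets at positive distance, the distance
    being measured by [f]. *)
Let mu_separated (f : X -> R) (a b : R) (E : set (borel X)) : continuous f -> a < b ->
  (mu (E `&` [set x | (b <= f x)%R]) + mu (E `&` [set x | (f x <= a)%R]) <= mu E)%E.
Proof.
move=> cf ab; apply: le_ereal_inf_tmp => _ [B [mB EB] <-].
have mge := ge_measurable b cf; have mle := le_measurable a cf.
apply: (@le_trans _ _ (\sum_(k <oo) capacity (B k `&` [set x | (b <= f x)%R]) +
    \sum_(k <oo) capacity (B k `&` [set x | (f x <= a)%R]))%E).
  apply: leeD; apply: ereal_inf_lbound.
    exists (fun k => B k `&` [set x | (b <= f x)%R]) => //; split.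
      by move=> k; apply: measurableI.
    by rewrite -setI_bigcupl; exact: setSI.
  exists (fun k => B k `&` [set x | (f x <= a)%R]) => //; split.
    by move=> k; apply: measurableI.
  by rewrite -setI_bigcupl; exact: setSI.
rewrite -nneseriesD//; apply: lee_nneseries => k *; first by rewrite adde_ge0.
exact: capacity_separated.
Qed.

Let mu_fin E : mu E \is a fin_num.
Proof.
rewrite ge0_fin_numE ?outer_measure_ge0//.
apply: (@le_lt_trans _ _ 1%E); last exact: ltry.
apply: (@le_trans _ _ (\sum_(k <oo) capacity (if k == 0%N then setT else set0))%E).
  apply: ereal_inf_lbound; exists (fun k => if k == 0%N then setT else set0) => //; split.
    by move=> k; case: ifP.
  by move=> x _; exists 0%N.
rewrite (nneseries_split 0%N 1%N)//= add0n big_nat1/= eseries0 ?adde0//.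
  by apply: ereal_inf_lbound; exists (fun=> 1); rewrite ?L1//; split.
by move=> [|k] // _ _.
Qed.

Let level (f : X -> R) (k : nat) : set (borel X) := [set x | (k.+1%:R^-1 <= f x)%R].

Let level_sub f j k : (j <= k)%N -> level f j `<=` level f k.
Proof. by move=> jk x; apply: le_trans; rewrite lef_pV2 ?posrE// ler_nat ltnS. Qed.

(* Shells of even index are separated from each other, and so are those of odd index:
   the series of their outer measures converges, which is what makes [{f > 0}]
   Caratheodory measurable. *)
Let shell (f : X -> R) (k : nat) : set (borel X) := level f k.+1 `\` level f k.

(** The shell of index 2K + i lies where f < 1 / (2K + i + 1), the earlier ones of the same parity
    where f >= 1 / (2K + i); the gap allows [mu_separated]. The condition [0 < i] makes the
    predecessor a true one. *)
Let shells_le f E (i K : nat) : continuous f -> (0 < i)%N ->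
  (\sum_(0 <= k < K) mu (E `&` shell f (k.*2 + i)) <=
   mu (E `&` level f (K.*2 + i).-1))%E.
Proof.
move=> cf i0; elim: K => [|K IH]; first by rewrite big_geq// outer_measure_ge0.
rewrite big_nat_recr// doubleS !addSn/=.
have Ki0 : (0 < K.*2 + i)%N by rewrite addn_gt0 i0 orbT.
have ab : (((K.*2 + i).+1%:R)^-1 < (((K.*2 + i).-1.+1)%:R)^-1 :> R)%R.
  by rewrite ltf_pV2 ?posrE// ltr_nat prednK.
apply: le_trans (@mu_separated f _ _ (E `&` level f (K.*2 + i).+1) cf ab).
apply: leeD.
  apply: le_trans IH _; apply: le_outer_measure => x [Ex fx]; split => //; split => //.
  by apply: level_sub fx; rewrite (leq_trans (leq_pred _)).
apply: le_outer_measure => x [Ex [fx nfx]]; split => //.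
by apply/ltW; rewrite ltNge; exact/negP.
Qed.

Let shells_sum f E K : continuous f ->
  (\sum_(0 <= k < K) mu (E `&` shell f k.+1) <= mu E + mu E)%E.
Proof.
move=> cf; apply: (@le_trans _ _ (\sum_(0 <= k < K.*2) mu (E `&` shell f k.+1))%E).
  apply: lee_sum_nneg_natr; last by rewrite -addnn leq_addr.
  by move=> n _ _; exact: outer_measure_ge0.
have -> : (\sum_(0 <= k < K.*2) mu (E `&` shell f k.+1) =
    \sum_(0 <= k < K) mu (E `&` shell f (k.*2 + 1)) + \sum_(0 <= k < K) mu (E `&` shell f (k.*2 + 2)))%E.
  elim: K => [|K IH]; first by rewrite !big_geq// adde0.
  by rewrite doubleS !big_nat_recr//= IH addn1 addn2 -!addeA; congr (_ + _)%E; rewrite addeCA.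
apply: leeD; apply: (le_trans (shells_le _ _ cf _)) => //.
  by apply: le_outer_measure => x [].
by apply: le_outer_measure => x [].
Qed.

Let shells_tail f E : continuous f ->
  (fun K => \sum_(K <= k <oo) mu (E `&` shell f k.+1))%E @ \oo --> 0%E.
Proof.
move=> cf; apply: nneseries_tail_cvg => [|k _]; last exact: outer_measure_ge0.
apply: (@le_lt_trans _ _ (mu E + mu E)%E).
  apply: lime_le; first by apply: is_cvg_nneseries => *; exact: outer_measure_ge0.
  by apply: nearW => K; exact: shells_sum.
by rewrite -ge0_fin_numE ?adde_ge0 ?outer_measure_ge0// fin_numD mu_fin.
Qed.

(** [level f K.+1] is separated from the set where f <= 0, and what it misses of the set where f > 0
    is covered by shells whose total outer measure is a tail tending to 0. *)
Let cozero_caratheodory (f : X -> R) : continuous f -> mu.-caratheodory [set x | (0 < f x)%R].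
Proof.
move=> cf; apply: le_caratheodory_measurable => E.
have H K : (mu (E `&` [set x | (0 < f x)%R]) + mu (E `&` ~` [set x | (0 < f x)%R]) <=
    mu E + \sum_(K <= k <oo) mu (E `&` shell f k.+1))%E.
  have ab : 0 < K.+2%:R^-1 :> R by rewrite invr_gt0.
  apply: (@le_trans _ _ (mu (E `&` level f K.+1) + \sum_(K <= k <oo) mu (E `&` shell f k.+1) +
      mu (E `&` ~` [set x | (0 < f x)%R]))%E); last first.
    rewrite addeAC leeD2r//; apply: le_trans (mu_separated E cf ab); apply: leeD => //.
    by apply: le_outer_measure => x [Ex] /negP; rewrite -leNgt.
  rewrite leeD2r//.
  apply: (@le_trans _ _ (mu (E `&` level f K.+1 `|` \bigcup_k (E `&` shell f (k + K).+1)))).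
    apply: le_outer_measure => x [Ex /= fx].
    have [lx|nlx] := pselect (level f K.+1 x); [by left|right].
    have [n nx] : exists n, level f n x.
      exists (Num.truncn (f x)^-1); rewrite /level/= -[leRHS]invrK lef_pV2 ?posrE ?invr_gt0//.
      by rewrite ltW// truncnS_gt.
    have ex : exists n, `[< level f n x >] by exists n; apply/asboolP.
    (* The least level [m] containing [x] puts it in the shell of index m - 1, which is one of the
       shells beyond [K]. *)
    case: (ex_minnP ex) => m /asboolP mx mmin.
    have Km : (K.+1 < m)%N.
      by rewrite ltnNge; apply/negP => mK; apply: nlx; exact: level_sub mx.
    have Em : (m - K.+2 + K).+2 = m by rewrite -!addnS subnK.
    exists (m - K.+2)%N => //; split => //; split; first by rewrite Em.
    by move=> l1; have := mmin (m - K.+2 + K).+1; rewrite asboolT// => /(_ isT); rewrite -{1}Em ltnn.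
  apply: le_trans (outer_measureU2 _ _ _) _; rewrite leeD2l//.
  apply: le_trans (outer_measure_sigma_subadditive mu _) _.
  rewrite (nneseries_addn (f := fun k => mu (E `&` shell f k.+1)))// => k.
  exact: outer_measure_ge0.
have Hc : (fun K => mu E + \sum_(K <= k <oo) mu (E `&` shell f k.+1))%E @ \oo --> mu E.
  rewrite -[X in _ --> X]adde0; apply: cvgeD.
  - by rewrite fin_num_adde_defr// mu_fin.
  - exact: cvg_cst.
  - exact: shells_tail.
by apply: (cvge_ge _ Hc); exact: nearW.
Qed.

Let L_cst c : L (fun=> c) = c.
Proof.
rewrite -[RHS]mulr1 -L1 -LZ; last exact: cstc.
by congr L; apply/funext => x; rewrite mulr1.
Qed.

Let L_sum (g : nat -> X -> R) N : (forall n, continuous (g n)) ->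
  continuous (fun x => \sum_(0 <= n < N) g n x) /\
  L (fun x => \sum_(0 <= n < N) g n x) = \sum_(0 <= n < N) L (g n).
Proof.
move=> cg; elim: N => [|N [cN LN]].
  rewrite (_ : (fun x => _) = fun=> 0) ?L0 ?big_geq//.
  by apply/funext => x; rewrite big_geq.
have E : (fun x => \sum_(0 <= n < N.+1) g n x) = (fun x => \sum_(0 <= n < N) g n x + g N x).
  by apply/funext => x; rewrite big_nat_recr.
rewrite E; split; first by move=> x; apply: cvgD; [exact: cN|exact: cg].
by rewrite LD// LN big_nat_recr.
Qed.

(** For the lower bound, take nearly optimal [g n] for a countable cover. The open sets where [g n]
    exceeds 1 - e cover the space, so by compactness finitely many of the [g n] have sum at least 1
    - e, and [L] is applied to it. One [e] is lost here, another in the choice of the [g n]. *)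
Let mu_setT : mu setT = 1%E.
Proof.
apply/eqP; rewrite eq_le; apply/andP; split.
  apply: (@le_trans _ _ (\sum_(k <oo) capacity (if k == 0%N then setT else set0))%E).
    apply: ereal_inf_lbound; exists (fun k => if k == 0%N then setT else set0) => //; split.
      by move=> k; case: ifP.
    by move=> x _; exists 0%N.
  rewrite (nneseries_split 0%N 1%N)//= add0n big_nat1/= eseries0 ?adde0//.
    by apply: ereal_inf_lbound; exists (fun=> 1); rewrite ?L1//; split.
  by move=> [|k] // _ _.
apply: le_ereal_inf_tmp => _ [B [mB EB] <-].
have capfin n : capacity (B n) \is a fin_num.
  rewrite ge0_fin_numE//; apply: (@le_lt_trans _ _ 1%E); last exact: ltry.
  by apply: ereal_inf_lbound; exists (fun=> 1); rewrite ?L1//; split.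
suff H (e : R) : 0 < e -> (1 <= \sum_(k <oo) capacity (B k) + e%:E + e%:E)%E.
  apply/lee_addgt0Pr => e e0; have e2 : 0 < e / 2 by rewrite divr_gt0.
  by have := H _ e2; rewrite -addeA -EFinD -splitr.
move=> e0.
have : forall n, exists g : X -> R, [/\ continuous g, forall x, 0 <= g x,
    forall x, B n x -> 1 <= g x & ((L g)%:E <= capacity (B n) + (e / (2 ^ n.+1)%:R)%:E)%E].
  move=> n; have en : 0 < e / (2 ^ n.+1)%:R :> R by rewrite divr_gt0// ltr0n expn_gt0.
  have [_ [g [cg g0 gB] <-] gle] := lb_ereal_inf_adherent en (capfin n).
  by exists g; split => //; exact: ltW.
move=> /choice[g gP].
have [D _ DX] : exists2 D : {fset nat}, {subset D <= setT} &
    setT `<=` cover [set` D] (fun n => [set x | 1 - e < g n x]).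
  move: X_compact; rewrite compact_cover; apply.
    move=> n _; have [cg _ _ _] := gP n.
    by move/continuousP : cg => /(_ [set y | 1 - e < y]); apply; exact: open_gt.
  move=> x _; have [n _ Bx] := EB x Logic.I; exists n => //=.
  have [_ _ /(_ _ Bx) g1 _] := gP n; apply: lt_le_trans g1; by rewrite ltrBlDr ltrDl.
pose N := (\max_(n <- enum_fset D) n).+1.
have cgN : forall n, continuous (g n) by move=> n; have [] := gP n.
have [cN LN] := L_sum N cgN.
have : 1 - e <= L (fun x => \sum_(0 <= n < N) g n x).
  rewrite -[leLHS]L_cst; apply: L_le; [exact: cstc|exact: cN|move=> x].
  have [n nD gn] := DX x Logic.I.
  have nN : n \in index_iota 0 N.
    by rewrite mem_index_iota/= ltnS; exact: (@leq_bigmax_seq _ _ xpredT id).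
  apply: (le_trans (ltW gn)); rewrite (bigD1_seq n nN (iota_uniq _ _)) lerDl.
  by apply: sumr_ge0 => i _; have [] := gP i.
rewrite LN lerBlDr => le1.
apply: (@le_trans _ _ ((\sum_(0 <= n < N) L (g n))%:E + e%:E)%E); first by rewrite -EFinD lee_fin.
rewrite leeD2r//; apply: (@le_trans _ _ (\sum_(k <oo) (capacity (B k) + (e / (2 ^ k.+1)%:R)%:E))%E).
  rewrite -sumEFin; apply: (@le_trans _ _ (\sum_(0 <= n < N) (capacity (B n) + (e / (2 ^ n.+1)%:R)%:E))%E).
    by apply: lee_sum => n _; have [] := gP n.
  apply: nneseries_lim_ge => n _ _; rewrite adde_ge0// lee_fin divr_ge0// ltW//.
apply: epsilon_trick => //; exact: ltW.
Qed.

Hypothesis open_cozero : forall U : set X, open U ->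
  exists2 f : nat -> X -> R, (forall n, continuous (f n)) & U = \bigcup_n [set x | 0 < f n x].

Let borel_caratheodory (B : set (borel X)) : measurable B -> mu.-caratheodory B.
Proof.
apply: (smallest_sub (@sigma_algebra_measurable _ (caratheodory_type mu))) => U /open_cozero[f cf ->].
by apply: caratheodory_measurable_bigcup => n; exact: cozero_caratheodory.
Qed.

(** A second name for [mu]: this one receives the structure of a probability on Borel sets, the
    other keeps that of an outer measure. *)
Definition riesz_measure : set (borel X) -> \bar R := mu.

Let riesz0 : riesz_measure set0 = 0%E. Proof. exact: outer_measure0. Qed.

Let riesz_ge0 B : (0 <= riesz_measure B)%E. Proof. exact: outer_measure_ge0. Qed.

Let riesz_additive : semi_sigma_additive riesz_measure.
Proof.
move=> F mF tF mUF; apply: (@caratheodory_measure_sigma_additive _ _ mu) => //.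
  by move=> n; exact: borel_caratheodory.
exact: borel_caratheodory.
Qed.

HB.instance Definition _ := isMeasure.Build _ _ _ riesz_measure riesz0 riesz_ge0 riesz_additive.
HB.instance Definition _ := Measure_isProbability.Build _ _ _ riesz_measure mu_setT.

Let m : probability (borel X) R := riesz_measure.

Let m_le (g : X -> R) (B : set (borel X)) : measurable B -> continuous g -> (forall x, 0 <= g x) ->
  (forall x, B x -> 1 <= g x) -> (m B <= (L g)%:E)%E.
Proof.
move=> mB cg g0 gB.
apply: (@le_trans _ _ (\sum_(k <oo) capacity (if k == 0%N then B else set0))%E).
  apply: ereal_inf_lbound; exists (fun k => if k == 0%N then B else set0) => //; split.
    by move=> k; case: ifP.
  by move=> x Bx; exists 0%N.
rewrite (nneseries_split 0%N 1%N)//= add0n big_nat1/= eseries0 ?adde0//.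
  by apply: ereal_inf_lbound; exists g.
by move=> [|k] // _ _.
Qed.

(** Apply [m_le] to 1 - g on the complement, where 1 - g >= 1. *)
Let m_ge (g : X -> R) : continuous g -> (forall x, 0 <= g x <= 1) ->
  ((L g)%:E <= m [set x | (0 < g x)%R])%E.
Proof.
move=> cg g01.
have mg : measurable ([set x | 0 < g x] : set (borel X)).
  by apply: sub_sigma_algebra; move/continuousP : cg => /(_ [set y | 0 < y]); apply; exact: open_gt.
have : (m (~` [set x | (0 < g x)%R]) <= (L (fun x => 1 + -1 * g x)%R)%:E)%E.
  apply: m_le.
  - exact: measurableC.
  - by move=> x; apply: cvgD; [exact: cvg_cst|apply: cvgM; [exact: cvg_cst|exact: cg]].
  - by move=> x; have /andP[_ g1] := g01 x; rewrite mulN1r subr_ge0.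
  - by move=> x /= /negP; rewrite -leNgt => g0; rewrite mulN1r lerDl oppr_ge0.
have -> : L (fun x => 1 + -1 * g x)%R = 1 - L g.
  rewrite LD; [|exact: cstc|by move=> x; apply: cvgM; [exact: cvg_cst|exact: cg]].
  by rewrite LZ// mulN1r L1.
rewrite probability_setC// EFinB leeBlDr ?fin_num_measure//.
rewrite -(fineK (fin_num_measure m _ mg)) -EFinB -EFinD !lee_fin.
by move=> ?; lra.
Qed.

(* A layer-cake decomposition of [t]. *)
Let clamp_sum (t : R) n : 0 <= t ->
  \sum_(0 <= k < n) Num.min (Num.max (t - k%:R) 0) 1 = Num.min t n%:R.
Proof.
move=> t0; elim: n => [|n IH]; first by rewrite big_geq//; apply/esym/min_idPr.
rewrite big_nat_recr//= IH -natr1.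
rewrite /Num.min /Num.max; do ![case: ifPn => //]; rewrite -?leNgt => *; lra.
Qed.

(** Cut n f into ramps [g k] of height 1. Then L (g (k+1)) <= m (f >= (k+1)/n) <= the integral of
    [g k], and summing loses only L (g 0) <= 1; division by n > 1/e makes this loss smaller than
    e. *)
Let m_Rintegral_ge (f : X -> R) : continuous f -> (forall x, 0 <= f x <= 1) ->
  L f <= \int[m]_x f x.
Proof.
move=> cf f01.
have intb (g : X -> R) : continuous g -> (forall x, 0 <= g x <= 1) ->
    m.-integrable setT (EFin \o (g : borel X -> R)).
  move=> cg g01; apply: (@bounded_integrable R X m setT g 1) => //.
    exact: borel_measurable_continuous.
  by move=> x; have /andP[? ?] := g01 x; rewrite ger0_norm.
apply/ler_addgt0Pr => e e0.
pose n := (Num.truncn e^-1).+1.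
have n0 : 0 < n%:R :> R by rewrite ltr0n.
pose g k x := ramp (k%:R / n%:R) (k.+1%:R / n%:R) f x.
have cg k : continuous (g k) by exact: ramp_continuous.
have g01 k x : 0 <= g k x <= 1 by exact: ramp_itv.
have gE k x : g k x = Num.min (Num.max (n%:R * f x - k%:R) 0) 1.
  rewrite /g /ramp -mulrBl -natr1 addrAC subrr add0r mul1r invrK mulrBr.
  by rewrite [n%:R * (_ / _)]mulrC divfK// gt_eqF.
have fE x : n%:R * f x = \sum_(0 <= k < n) g k x.
  have /andP[fx0 fx1] := f01 x.
  rewrite (eq_bigr (fun k => Num.min (Num.max (n%:R * f x - k%:R) 0) 1)) => [|k _]; last exact: gE.
  by rewrite clamp_sum ?mulr_ge0//; apply/esym/min_idPl; rewrite ler_piMr// ltW.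
have Lf : n%:R * L f = \sum_(0 <= k < n) L (g k).
  rewrite -LZ// (_ : (fun x => _) = (fun x => \sum_(0 <= k < n) g k x)); last exact/funext.
  by have [] := L_sum n cg.
have Lg k : L (g k.+1) <= \int[m]_x g k x.
  have mge := ge_measurable (k.+1%:R / n%:R) cf.
  apply: (@le_trans _ _ (fine (m [set x | k.+1%:R / n%:R <= f x]))).
    rewrite -lee_fin fineK ?fin_num_measure//; apply: le_trans (m_ge (cg k.+1) (g01 k.+1)) _.
    apply: le_measure; rewrite ?inE//.
      apply: sub_sigma_algebra; move/continuousP : (cg k.+1) => /(_ [set y | 0 < y]); apply; exact: open_gt.
    move=> x /= g0; rewrite leNgt; apply/negP => fx; move: g0.
    by rewrite /g ramp_le ?ltxx ?ltr_pM2r ?invr_gt0 ?ltr_nat// ltW.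
  have -> : fine (m [set x | k.+1%:R / n%:R <= f x]) =
      \int[m]_x \1_([set x | k.+1%:R / n%:R <= f x] : set (borel X)) x.
    by rewrite /Rintegral integral_indic// setIT.
  apply: le_Rintegral => //.
  - apply: (@bounded_integrable R X m setT _ 1) => // x.
    by rewrite indicE; case: (_ \in _); rewrite ?normr1 ?normr0.
  - exact: intb.
  move=> x _; rewrite indicE; case: (boolP (_ \in _)) => [|_]; last by have /andP[] := g01 k x.
  by rewrite inE /= => fx; rewrite /g ramp_ge// ltr_pM2r ?invr_gt0// ltr_nat.
have sumb N x : 0 <= \sum_(0 <= k < N) g k x <= N%:R.
  apply/andP; split; first by apply: sumr_ge0 => k _; have /andP[] := g01 k x.
  elim: N => [|N IH]; first by rewrite big_geq.
  by rewrite big_nat_recr//= -natr1 lerD//; have /andP[] := g01 N x.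
have int_sum N : m.-integrable setT (EFin \o ((fun x => \sum_(0 <= k < N) g k x) : borel X -> R)) /\
    \int[m]_x (\sum_(0 <= k < N) g k x) = \sum_(0 <= k < N) \int[m]_x g k x.
  have iN M : m.-integrable setT (EFin \o ((fun x => \sum_(0 <= k < M) g k x) : borel X -> R)).
    apply: (@bounded_integrable R X m setT _ M%:R) => // [|x].
      by apply: borel_measurable_continuous; have [] := L_sum M cg.
    by have /andP[? ?] := sumb M x; rewrite ger0_norm.
  split=> //; elim: N => [|N IH].
    rewrite big_geq//; under [LHS]eq_Rintegral do rewrite big_geq//.
    by rewrite Rintegral_cst// mul0r.
  rewrite big_nat_recr//= -IH -RintegralD//; last exact: intb.
  by apply: eq_Rintegral => x _; rewrite big_nat_recr.
have If : n%:R * \int[m]_x f x = \sum_(0 <= k < n) \int[m]_x g k x.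
  have [_ <-] := int_sum n; rewrite -RintegralZl//; last exact: intb.
  by apply: eq_Rintegral => x _; exact: fE.
have I0 k : 0 <= \int[m]_x g k x.
  by apply: Rintegral_ge0 => x _; have /andP[] := g01 k x.
have Lg1 : L (g 0%N) <= 1.
  by rewrite -L1; apply: L_le; [exact: cg|exact: cstc|move=> x; have /andP[] := g01 0%N x].
have key : n%:R * L f <= 1 + n%:R * \int[m]_x f x.
  rewrite Lf If /n big_nat_recl//; apply: lerD => //.
  apply: (@le_trans _ _ (\sum_(0 <= k < Num.truncn e^-1) \int[m]_x g k x)).
    by apply: ler_sum => k _; exact: Lg.
  by rewrite big_nat_recr//= lerDl.
rewrite -(ler_pM2l n0) mulrDr; apply: (le_trans key); rewrite addrC lerD2l.
have : e^-1 < n%:R by rewrite /n truncnS_gt.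
by move=> /ltW; rewrite -(ler_pM2r e0) mulVf ?gt_eqF.
Qed.

Let int_cst (c : R) : \int[m]_x c = c.
Proof. transitivity (c * fine (m setT)); first exact: Rintegral_cst.
by have -> : m setT = 1%E := mu_setT; rewrite mulr1. Qed.

Let m_Rintegral01 (f : X -> R) : continuous f -> (forall x, 0 <= f x <= 1) ->
  \int[m]_x f x = L f.
Proof.
move=> cf f01; apply/eqP; rewrite eq_le m_Rintegral_ge// andbT.
have cNf : continuous (fun x => -1 * f x + 1).
  by move=> x; apply: cvgD; [apply: cvgM; [exact: cvg_cst|exact: cf]|exact: cvg_cst].
have := @m_Rintegral_ge (fun x => -1 * f x + 1) cNf.
rewrite (L_linear (-1) cf (@cstc 1)).
have fi : m.-integrable setT (EFin \o (f : borel X -> R)).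
  apply: (@bounded_integrable R X m setT f 1) => //.
    exact: borel_measurable_continuous.
  by move=> x; have /andP[? ?] := f01 x; rewrite ger0_norm.
have -> : \int[m]_x (-1 * f x + 1) = 1 - \int[m]_x f x.
  have i1 : m.-integrable setT (EFin \o (cst 1 : borel X -> R)).
    by apply: (@bounded_integrable R X m setT _ 1) => // x; rewrite normr1.
  have E : \int[m]_x (cst 1 x : R) = 1.
    exact: int_cst.
  rewrite -[X in X - _]E -RintegralB//; apply: eq_Rintegral => x _ /=.
  by rewrite mulN1r addrC.
rewrite L1 mulN1r addrC lerD2l lerN2; apply=> x.
by have /andP[? ?] := f01 x; rewrite mulN1r addrC subr_ge0 lerBlDr lerDl; apply/andP.
Qed.

(** The second clause is what shows that open sets missing an orbit are null. It follows from [m_le]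
    for (k + 1) f on [level f k]. *)
Theorem riesz_existence : exists m : probability (borel X) R,
  (forall f : X -> R, continuous f -> \int[m]_x f x = L f) /\
  (forall f : X -> R, continuous f -> (forall x, 0 <= f x) -> L f = 0 ->
    m [set x | (0 < f x)%R] = 0%E).
Proof.
exists m; split=> [f cf|f cf f0 Lf0]; last first.
  rewrite (_ : [set x | 0 < f x] = \bigcup_k level f k); last first.
    apply/seteqP; split=> [x fx|x [k _]].
      exists (Num.truncn (f x)^-1) => //; rewrite /level/= -[leRHS]invrK lef_pV2 ?posrE ?invr_gt0//.
      by rewrite ltW// truncnS_gt.
    by apply: lt_le_trans; rewrite invr_gt0 ltr0n.
  have ml k : m (level f k) = 0%E.
    apply/eqP; rewrite eq_le measure_ge0 andbT.
    rewrite [leRHS](_ : _ = (L (fun x => k.+1%:R * f x))%:E); last by rewrite LZ// Lf0 mulr0.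
    apply: m_le => [||x|x].
    - exact: ge_measurable.
    - by move=> x; apply: cvgM; [exact: cvg_cst|exact: cf].
    - by rewrite mulr_ge0.
    - by rewrite /level/= -(ler_pM2l (_ : 0 < k.+1%:R :> R)) ?ltr0n// divff ?pnatr_eq0.
  apply/eqP; rewrite eq_le measure_ge0 andbT.
  apply: (le_trans (outer_measure_sigma_subadditive mu _)).
  by rewrite eseries0// => k _ _; exact: ml.
have [M [M0 Mf]] : exists M : R, 0 < M /\ forall x, `|f x| <= M.
  have /compact_bounded[N [_ Nf]] : compact (f @` setT).
    by apply: continuous_compact => //; apply: continuous_subspaceT.
  exists (`|N| + 1); split=> [|x]; first by rewrite ltr_wpDl.
  by apply: Nf; [rewrite (le_lt_trans (ler_norm N))// ltrDl|exists x].
(* With |f| <= M, the function c f + 1/2 takes values in [0, 1]; linearity undoes the rescaling. *)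
pose c : R := (2 * M)^-1; have c0 : 0 < c by rewrite invr_gt0 mulr_gt0.
have fi : m.-integrable setT (EFin \o (f : borel X -> R)).
  apply: (@bounded_integrable R X m setT f M) => //.
  exact: borel_measurable_continuous.
have cf1 : continuous (fun x => c * f x + 2^-1).
  by move=> x; apply: cvgD; [apply: cvgM; [exact: cvg_cst|exact: cf]|exact: cvg_cst].
have := @m_Rintegral01 _ cf1; rewrite (L_linear c cf (@cstc 2^-1)).
have icf : m.-integrable setT (EFin \o ((fun x => c * f x) : borel X -> R)).
  apply: (@bounded_integrable R X m setT _ (c * M)) => //.
    by apply: borel_measurable_continuous => x; apply: cvgM; [exact: cvg_cst|exact: cf].
  by move=> x; rewrite normrM (gtr0_norm c0) ler_pM2l.
rewrite RintegralD//; last first.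
  by apply: (@bounded_integrable R X m setT _ 2^-1) => // x; rewrite ger0_norm.
rewrite RintegralZl// int_cst L_cst => H.
apply: (mulfI (lt0r_neq0 c0)); apply: (addIr 2^-1); apply: H => x.
have := Mf x; rewrite ler_norml => /andP[f1 f2].
have h1 : c * f x <= c * M by rewrite ler_pM2l.
have h2 : c * - M <= c * f x by rewrite ler_pM2l.
have E : c * M = 2^-1 by rewrite /c invfM -mulrA mulVf ?mulr1// gt_eqF.
by rewrite mulrN E in h2; rewrite E in h1; apply/andP; split; lra.
Qed.

End RieszExistence.

(** * Invariant means *)

Section InvariantMean.
Variables (R : realType) (I : zmodType).
Implicit Types (f g h : I -> R) (e : nat -> I).

Definition shift_avg (y : I) (n : nat) f (x : I) : R :=
  n.+1%:R^-1 * \sum_(0 <= j < n.+1) f (x + y *+ j).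

(** The average over the box of sums of j_i e_i with i < k and 0 <= j_i <= n, counted with
    multiplicity. *)
Fixpoint iter_avg e (n k : nat) f : I -> R :=
  if k is k'.+1 then shift_avg (e k') n (iter_avg e n k' f) else f.

Lemma shift_avg_le y n f (M : R) : (forall x, `|f x| <= M) -> forall x, `|shift_avg y n f x| <= M.
Proof.
move=> fM x; rewrite /shift_avg normrM ger0_norm ?invr_ge0//.
rewrite mulrC ler_pdivrMr ?ltr0n//; apply: (le_trans (ler_norm_sum _ _ _)).
apply: (@le_trans _ _ (\sum_(0 <= j < n.+1) M)); first exact: ler_sum.
by rewrite sumr_const_nat subn0 mulr_natr.
Qed.

Lemma iter_avg_le e n k f (M : R) : (forall x, `|f x| <= M) -> forall x, `|iter_avg e n k f x| <= M.
Proof. by move=> fM; elim: k => //= k IH; exact: shift_avg_le. Qed.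

Lemma iter_avg_ge0 e n k f : (forall x, 0 <= f x) -> forall x, 0 <= iter_avg e n k f x.
Proof.
by move=> f0; elim: k => //= k IH x; rewrite mulr_ge0 ?invr_ge0// sumr_ge0.
Qed.

Lemma iter_avg_linear e n k c f g x :
  iter_avg e n k (fun x => c * f x + g x) x = c * iter_avg e n k f x + iter_avg e n k g x.
Proof.
elim: k x => //= k IH x; rewrite /shift_avg (eq_bigr _ (fun j _ => IH _)).
by rewrite big_split/= -big_distrr/= mulrDr mulrCA.
Qed.

Lemma iter_avg_cst e n k (c : R) x : iter_avg e n k (fun=> c) x = c.
Proof.
elim: k x => //= k IH x; rewrite /shift_avg (eq_bigr _ (fun j _ => IH _)).
by rewrite sumr_const_nat subn0 -[c *+ _]mulr_natl mulKf// pnatr_eq0.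
Qed.

Lemma iter_avg_shift e n k f y x :
  iter_avg e n k (fun x => f (x + y)) x = iter_avg e n k f (x + y).
Proof.
elim: k x => //= k IH x; rewrite /shift_avg (eq_bigr _ (fun j _ => IH _)).
by congr (_ * _); apply: eq_bigr => j _; rewrite addrAC.
Qed.

(* Only the average in the direction [e l] matters; its two end points give [2 * M]. *)
Lemma iter_avg_invariant e n k l f (M : R) : (l < k)%N -> (forall x, `|f x| <= M) ->
  forall x, `|iter_avg e n k (fun x => f (x + e l)) x - iter_avg e n k f x| <= 2 * M / n.+1%:R.
Proof.
move=> + fM; elim: k => // k IH; rewrite ltnS leq_eqVlt => /predU1P[->{l IH}|lk] x /=.
  rewrite /shift_avg (eq_bigr _ (fun j _ => iter_avg_shift _ _ _ _ _ _)) -mulrBr.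
  set h := iter_avg e n k f.
  have -> : \sum_(0 <= j < n.+1) h (x + e k *+ j + e k) - \sum_(0 <= j < n.+1) h (x + e k *+ j) =
      h (x + e k *+ n.+1) - h x.
    rewrite -sumrB (telescope_sumr_eq (fun j => h (x + e k *+ j)))//.
      by rewrite mulr0n addr0.
    by move=> j _; rewrite mulrSr addrA.
  rewrite mulrC normrM [X in _ * X]ger0_norm ?invr_ge0// ler_wpM2r ?invr_ge0//.
  by rewrite (le_trans (ler_normB _ _))// mulr2n mulrDl mul1r lerD// iter_avg_le.
rewrite -[X in X - _]/(shift_avg _ _ _ _) /shift_avg -mulrBr -sumrB.
exact: (@shift_avg_le (e k) n
  (fun x => iter_avg e n k (fun x => f (x + e l)) x - iter_avg e n k f x) _ (IH lk)).
Qed.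

Definition bounded_fct f := exists M : R, forall x, `|f x| <= M.

(** Take k = n and an ultralimit. Every [y] is some [e l], and as soon as l < n the defect of
    invariance under [e l] is at most 2M / (n + 1). *)
Lemma invariant_mean : countable [set: I] -> exists M : (I -> R) -> R,
  [/\ forall c f g, bounded_fct f -> bounded_fct g -> M (fun x => c * f x + g x) = c * M f + M g,
      forall f, bounded_fct f -> (forall x, 0 <= f x) -> 0 <= M f,
      M (fun=> 1) = 1 &
      forall f y, bounded_fct f -> M (fun x => f (x + y)) = M f].
Proof.
move=> /countable_enumeration[e eI].
have [U [UU oU]] : exists U : set_system nat, UltraFilter U /\ \oo `<=` U by exact: ultraFilterLemma.
pose m n f : R := iter_avg e n n f 0.
have cvgm f : bounded_fct f -> cvg ((fun n => m n f) @ U).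
  by move=> [M fM]; apply: (ultra_cvg_bounded UU (M := M)) => n; exact: iter_avg_le.
exists (fun f => lim ((fun n => m n f) @ U)); split.
- move=> c f g bf bg; apply: cvg_lim => //.
  rewrite (_ : (fun n => _) = (fun n => c * m n f + m n g)); last first.
    by apply/funext => n; exact: iter_avg_linear.
  by apply: cvgD; [apply: cvgMr|]; exact: cvgm.
- move=> f bf f0; apply: limr_ge; first exact: cvgm.
  by apply: nearW => n; exact: iter_avg_ge0.
- apply: cvg_lim => //; rewrite (_ : (fun n => _) = (fun=> 1)); first exact: cvg_cst.
  by apply/funext => n; exact: iter_avg_cst.
- move=> f y [M fM]; have [l <-] := eI y.
  have bf : bounded_fct f by exists M.
  have bfy : bounded_fct (fun x => f (x + e l)) by exists M.
  apply/eqP; rewrite -subr_eq0; apply/eqP.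
  have d : (fun n => m n (fun x => f (x + e l)) - m n f) @ U --> (0 : R).
    apply: (@cvg_trans _ ((fun n => m n (fun x => f (x + e l)) - m n f) @ \oo)).
      by move=> B /= ?; exact: oU.
    apply/norm_cvg0P.
    apply: (@squeeze_cvgr _ _ _ _ (cst 0) (fun n => 2 * M * n.+1%:R^-1)); last 2 first.
    + exact: cvg_cst.
    + by rewrite -[X in _ --> X](mulr0 (2 * M)); apply: cvgMr; exact: cvg_harmonic.
    near=> n; rewrite normr_ge0/=; apply: iter_avg_invariant => //.
    by near: n; exists l.+1.
  rewrite -(cvg_lim _ d)//; apply/esym/cvg_lim => //.
  by apply: cvgB; exact: cvgm.
Unshelve. all: by end_near. Qed.

End InvariantMean.

Section ContinuousFunctions.
Variables (R : realType) (X : topologicalType).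
Implicit Types f g : X -> R.

Lemma continuous_max0 f : continuous f -> continuous (fun x => Num.max (f x) 0).
Proof.
move=> cf x; apply: (@continuous_max _ _ f (fun=> 0)); last exact: cvg_cst.
exact: cf.
Qed.

Lemma continuous_subc f c : continuous f -> continuous (fun x => f x - c).
Proof. by move=> cf x; apply: cvgB; [exact: cf|exact: cvg_cst]. Qed.

Lemma continuous_mul f g : continuous f -> continuous g -> continuous (fun x => f x * g x).
Proof. by move=> cf cg x; apply: cvgM; [exact: cf|exact: cg]. Qed.

End ContinuousFunctions.

(** * Cozero sets and continuous functions on the dual *)

Section CharacterRiesz.
Variables (R : realType) (A : zmodType).
Local Notation X := (character R A).
Hypothesis countA : countable [set: A].

Lemma cylinder_cozero (s : seq (R[i] * A * R)) :
  exists2 f : X -> R, continuous f & cylinder s = [set w | 0 < f w].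
Proof.
suff [f [cf f0 fs]] : exists f : X -> R, [/\ continuous f, forall w, 0 <= f w & cylinder s = [set w | 0 < f w]].
  by exists f.
elim: s => [|[[z a] c] s [f [cf f0 fs]]].
  exists (fun=> 1); split=> //; first exact: cst_continuous.
  by apply/seteqP; split=> w //= _; exact: ltr01.
exists (fun w => Num.max (trig z a w - c) 0 * f w); split.
- apply: continuous_mul => //; apply: continuous_max0.
  by apply: continuous_subc; exact: trig_continuous.
- by move=> w; rewrite mulr_ge0// le_max lexx orbT.
- rewrite -cat1s cylinder_cat fs; apply/seteqP; split=> w /=.
    by move=> [+ fw]; rewrite /cylinder/= andbT => cw; rewrite mulr_gt0// lt_max subr_gt0 cw.
  move=> H; have fw : 0 < f w.
    by rewrite lt_neqAle f0 andbT; apply/eqP => E; move: H; rewrite -E mulr0 ltxx.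
  by split=> //; move: H; rewrite pmulr_lgt0// lt_max ltxx orbF subr_gt0 /cylinder/= andbT.
Qed.

Lemma open_cozero (U : set X) : open U ->
  exists2 f : nat -> X -> R, (forall n, continuous (f n)) & U = \bigcup_n [set x | 0 < f n x].
Proof.
move=> oU; have [e eA] := countable_enumeration countA.
have : forall n, exists f : X -> R, continuous f /\
    [set w | 0 < f w] = if (choice.unpickle n : option (seq (nat * bool * bool * rat))) is Some s then
      (if `[< rational_cylinder e s `<=` U >] then @rational_cylinder R A e s else set0) else set0.
  move=> n.
  (* The zero function fills the indices that decode to no cylinder inside [U]. *)
  have z : exists f : X -> R, continuous f /\ [set w | 0 < f w] = set0.
    exists (fun=> 0); split; first exact: cst_continuous.
    by apply/seteqP; split=> w //=; rewrite ltxx.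
  case: (choice.unpickle n) => [s|//]; case: ifPn => _ //.
  by have [f cf fs] := cylinder_cozero (map (rational_cond R e) s); exists f.
move=> /choice[f fP]; exists f; first by move=> n; have [] := fP n.
rewrite {1}(open_rational_cylinders eA oU); apply/seteqP; split=> [w [s sU sw]|w [n _]].
  by exists (choice.pickle s) => //; have [_ ->] := fP (choice.pickle s); rewrite choice.pickleK asboolT.
have [_ ->] := fP n; case: (choice.unpickle n) => [s|//]; case: ifPn => // /asboolP sU sw.
by exists s.
Qed.

Lemma character_bounded (f : X -> R) : continuous f -> exists M : R, forall w, `|f w| <= M.
Proof.
move=> cf; have /compact_bounded[N [_ Nf]] : compact (f @` setT).
  by apply: continuous_compact; [exact: continuous_subspaceT|exact: character_compact].
exists (`|N| + 1) => w.
by apply: Nf; [rewrite (le_lt_trans (ler_norm N))// ltrDl|exists w].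
Qed.

End CharacterRiesz.

(** * Affine maps of the dual and transported measures *)

Section Transport.
Variables (R : realType) (A : zmodType).
Local Notation X := (character R A).

(** Such a map turns each [trig] into another [trig]. The one-sided and two-sided actions,
    translations and reflections all have this form. *)
Lemma affine_continuous (T : X -> X) (c : A -> R[i]) (phi : A -> A) :
  (forall v a, T v a = c a * v (phi a)) -> continuous T.
Proof.
move=> Tphi v; apply: (@character_cvg R A (T @ v) _ (fmap_filter T (nbhs_filter v))) => z a.
have E u : trig z a (T u) = trig (z * c a) (phi a) u by rewrite /trig Tphi mulrA.
rewrite E (_ : trig z a @ (T @ v) = trig (z * c a) (phi a) @ v); first exact: trig_continuous.
by rewrite -(funext E).
Qed.

Variable T : X -> X.
Hypothesis T_continuous : continuous T.

Lemma transport_measurable : measurable_fun [set: borel X] (T : borel X -> borel X).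
Proof.
move=> mT; apply: (measurability _ (erefl (@measurable _ (borel X)))) => // _ [U oU <-].
rewrite setTI; apply: sub_sigma_algebra.
by move/continuousP : T_continuous; apply.
Qed.

Lemma preimage_borel_measurable (B : set (borel X)) :
  measurable B -> measurable (T @^-1` B : set (borel X)).
Proof. by move=> mB; rewrite -[T @^-1` B]setTI; exact: transport_measurable. Qed.

Definition transport_mfun : {mfun borel X >-> borel X} :=
  HB.pack (T : borel X -> borel X) (isMeasurableFun.Build _ _ _ _ _ transport_measurable).

Lemma Rintegral_transport (m : probability (borel X) R) (D : set (borel X)) z a : measurable D ->
  \int[distribution m transport_mfun]_(v in D) trig z a v =
  \int[m]_(v in T @^-1` D) trig z a (T v).
Proof.
move=> mD; rewrite /Rintegral /distribution integral_pushforward//.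
- by apply/measurable_EFinP; exact: trig_measurable.
- apply: (@bounded_integrable R _ m _ _ (complex.Re `|z|)).
  + exact: preimage_borel_measurable.
  + apply: measurableT_comp; [exact: trig_measurable|exact: transport_measurable].
  + by move=> v; exact: trig_le.
Qed.

(** [trig_determines] for the image measure: every equality between a measure and a translate of
    another is checked on coefficients through this lemma. *)
Lemma transport_determined (m1 m2 : probability (borel X) R) : countable [set: A] ->
  (forall z a, \int[m1]_v trig z a (T v) = \int[m2]_v trig z a v) ->
  forall B : set (borel X), measurable B -> m1 (T @^-1` B) = m2 B.
Proof.
move=> cA m12 B mB.
have := @trig_determines R A (distribution m1 transport_mfun) m2 setT setT 1 cA measurableT measurableT.
have H z a : (\int[distribution m1 transport_mfun]_(w in setT) trig z a w =
    1 * \int[m2]_(w in setT) trig z a w)%R.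
  by rewrite mul1r -m12 Rintegral_transport.
move=> /(_ H B mB); rewrite !setTI mul1r => E.
have : (fine (m1 (T @^-1` B)))%:E = (fine (m2 B))%:E by rewrite -E.
by rewrite !fineK ?fin_num_measure//; exact: preimage_borel_measurable.
Qed.

Lemma Rintegral_invariant (m : probability (borel X) R) (B : set (borel X)) z a :
  countable [set: A] -> (forall z a, \int[m]_v trig z a (T v) = \int[m]_v trig z a v) ->
  measurable B -> T @^-1` B = B ->
  \int[m]_(v in B) trig z a (T v) = \int[m]_(v in B) trig z a v.
Proof.
move=> cA mT mB TB; rewrite -[X in \int[m]_(v in X) trig z a (T v)]TB -Rintegral_transport//.
congr fine; apply: eq_measure_integral => C mC _.
exact: (transport_determined cA mT mC).
Qed.

End Transport.

(** * One-sided actions *)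

(** With y = z / (c - 1), z = yc - y. Additivity alone is assumed because the coefficients are real
    while [c] is complex. *)
Lemma additive_fixed (R : realType) (u : R[i] -> R) (c : R[i]) : (forall z z', u (z + z') = u z + u z') ->
  (forall z, u (z * c) = u z) -> c != 1 -> forall z, u z = 0.
Proof.
move=> uD uc c1 z.
have d0 : c - 1 != 0 by rewrite subr_eq0.
have u0 : u 0 = 0 by apply: (addrI (u 0)); rewrite -uD !addr0.
have E : z = - (z / (c - 1)) + z / (c - 1) * c.
  by rewrite addrC -[X in _ - X]mulr1 -mulrBr mulfVK.
by rewrite {1}E uD uc -uD addNr.
Qed.

Section OneSided.
Variables (R : realType) (A : zmodType) (op mul : A -> A -> A).
Local Notation X := (character R A).
Hypothesis countA : countable [set: A].
Hypothesis opDl : forall x y a, op (x + y) a = op x a + op y a.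
Hypothesis opDr : forall x a b, op x (a + b) = op x a + op x b.
Hypothesis op_mul : forall x y a, op x (op y a) = op (mul x y) a.
Hypothesis op_nil : forall x a, exists n, iter n (op x) a = 0.
Implicit Types (w v : X) (x y a b : A).

Fact twistD w x v a b :
  v (a + b) * w (op x (a + b)) = v a * w (op x a) * (v b * w (op x b)).
Proof. by rewrite opDr !chiD mulrACA. Qed.

Fact twist_norm1 w x v a : `|v a * w (op x a)| = 1.
Proof. by rewrite normrM !chi_norm1 mulr1. Qed.

(** For fixed [w], a translation of the dual group, by a character depending additively on [x];
    [op_act x] is instead an automorphism of the dual. The two agree at the base point [w]. *)
Definition twist w x v : X := Character (twistD w x v) (twist_norm1 w x v).

Definition op_act x w : X := twist w x w.

Lemma op_actE x w a : op_act x w a = w (a + op x a).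
Proof. by rewrite chiD. Qed.

(** The annihilator in [A] of the group of characters a -> w (op x a) by which the orbit of [w] is a
    coset. *)
Definition op_kernel w : set A := [set a | forall x, w (op x a) = 1].

(** On the kernel, [trig z a] is constant along the orbit. Off it, a shift by [y] replaces [z] by
    [z * w (op y a)], and [additive_fixed] applies. For the null sets, write [U] as a union of
    cozero sets and use positive parts, which vanish on the orbit. *)
Lemma coset_measure_exists w : exists m : probability (borel X) R,
  (forall z a, \int[m]_v trig z a v = if `[< op_kernel w a >] then trig z a w else 0) /\
  (forall U : set X, open U -> (forall x, ~ U (op_act x w)) -> m U = 0%E).
Proof.
have [M [Mlin M0 M1 Minv]] := @invariant_mean R A countA.
pose L (f : X -> R) := M (fun x => f (op_act x w)).
have bL (f : X -> R) : continuous f -> bounded_fct (fun x => f (op_act x w)).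
  by move=> /character_bounded[B fB]; exists B.
have Llin c (f g : X -> R) : continuous f -> continuous g -> L (fun v => c * f v + g v) = c * L f + L g.
  by move=> cf cg; apply: Mlin; exact: bL.
have Lge0 (f : X -> R) : continuous f -> (forall v, 0 <= f v) -> 0 <= L f.
  by move=> cf f0; apply: M0 => //; exact: bL.
have Lcst c : L (fun=> c) = c.
  have := @Mlin c (fun=> 1) (fun=> 0); rewrite /L.
  have b (d : R) : bounded_fct (fun _ : A => d) by exists `|d|.
  have -> : M (fun=> 0) = 0.
    have := Mlin (-1) (fun=> 0) (fun=> 0) (b 0) (b 0).
    rewrite (_ : (fun _ : A => -1 * 0 + 0) = (fun=> 0)); last by apply/funext => ?; rewrite mulr0 addr0.
    by rewrite mulN1r addNr.
  rewrite M1 (_ : (fun _ : A => c * 1 + 0) = (fun=> c)); last by apply/funext => ?; rewrite mulr1 addr0.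
  by rewrite mulr1 addr0; apply; exact: b.
have [m [mL m0]] := riesz_existence (@character_compact R A) Llin Lge0 (Lcst 1) (open_cozero countA).
exists m; split=> [z a|U oU Uw]; last first.
  have [f cf UE] := open_cozero countA oU.
  have mf n : m [set v | (0 < f n v)%R] = 0%E.
    rewrite (_ : [set v | 0 < f n v] = [set v | 0 < Num.max (f n v) 0]); last first.
      by apply/seteqP; split=> v /=; rewrite lt_max ltxx orbF.
    have cm : continuous (fun v => Num.max (f n v) 0) by exact: continuous_max0.
    apply: m0 => // [v|]; first by rewrite le_max lexx orbT.
    transitivity (L (fun=> 0)); last exact: Lcst.
    congr M; apply/funext => x; apply/max_idPr; rewrite leNgt.
    by apply/negP => fx; apply: (Uw x); rewrite UE; exists n.
  apply/eqP; rewrite eq_le measure_ge0 andbT UE.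
  apply: (@le_trans _ _ (\sum_(0 <= k <oo) m [set v | (0 < f k v)%R])%E).
    apply: (measure_sigma_subadditive (R := R) (T := borel X)) => // [k|].
      by apply: sub_sigma_algebra; move/continuousP : (cf k) => /(_ [set y | 0 < y]); apply; exact: open_gt.
    by apply: sub_sigma_algebra; rewrite -UE.
  by rewrite eseries0.
rewrite mL; last exact: trig_continuous.
have Lz (c : R[i]) : L (trig c a) = M (fun x => complex.Re (c * (w a * w (op x a)))) by [].
case: ifPn => [/asboolP aK|/asboolP aK].
  rewrite -[RHS]Lcst; congr M; apply/funext => x.
  by rewrite /trig /= aK mulr1.
have [y wy] : exists y, w (op y a) != 1.
  by apply: contrapT => H; apply: aK => x; apply/eqP; apply: contrapT => wx; apply: H; exists x; exact/negP.
have LzD c d : L (trig (c + d) a) = L (trig c a) + L (trig d a).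
  rewrite -[L (trig c a)]mul1r -Llin; [|exact: trig_continuous|exact: trig_continuous].
  by congr L; apply/funext => v; rewrite /trig mul1r mulrDl raddfD.
have Lzy c : L (trig (c * w (op y a)) a) = L (trig c a).
  rewrite !Lz -[RHS](Minv _ y); last by apply: (bL (trig c a)); exact: trig_continuous.
  congr M; apply/funext => x; congr (complex.Re _).
  by rewrite opDl chiD mulrCA !mulrA [c * _]mulrC -!mulrA [w (op y a) * _]mulrC mulrCA.
exact: (additive_fixed LzD Lzy wy).
Qed.

Definition coset_haar w : probability (borel X) R := projT1 (cid (coset_measure_exists w)).

Lemma coset_haar_trig w z a :
  \int[coset_haar w]_v trig z a v = if `[< op_kernel w a >] then trig z a w else 0.
Proof. by rewrite /coset_haar; case: cid => m [? ?] /=. Qed.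

Lemma coset_haar_null w (U : set X) : open U -> (forall x, ~ U (op_act x w)) ->
  coset_haar w U = 0%E.
Proof. by rewrite /coset_haar; case: cid => m [? H] /=; exact: H. Qed.

Lemma op0l a : op 0 a = 0.
Proof. by apply: (addrI (op 0 a)); rewrite -opDl !addr0. Qed.

Lemma op0r x : op x 0 = 0.
Proof. by apply: (addrI (op x 0)); rewrite -opDr !addr0. Qed.

Lemma opNl x a : op (- x) a = - op x a.
Proof. by apply: (addrI (op x a)); rewrite -opDl !subrr op0l. Qed.

Lemma opNr x a : op x (- a) = - op x a.
Proof. by apply: (addrI (op x a)); rewrite -opDr !subrr op0r. Qed.

Lemma op_kernel0 w : op_kernel w 0.
Proof. by move=> x; rewrite op0r chi0. Qed.

Lemma op_kernelB w a b : op_kernel w a -> op_kernel w b -> op_kernel w (a - b).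
Proof. by move=> aK bK x; rewrite opDr opNr chiD aK mul1r chiN bK conjc1. Qed.

Lemma op_kernelN w a : op_kernel w a -> op_kernel w (- a).
Proof. by move=> aK; rewrite -[- a]sub0r; apply: op_kernelB => //; exact: op_kernel0. Qed.

Lemma op_kernelD w a b : op_kernel w a -> op_kernel w b -> op_kernel w (a + b).
Proof. by move=> aK bK; rewrite -[b]opprK; apply: op_kernelB => //; exact: op_kernelN. Qed.

Lemma op_kernel_op w x a : op_kernel w a -> op_kernel w (op x a).
Proof. by move=> aK y; rewrite op_mul aK. Qed.

Lemma op_kernel_iter w x a n : op_kernel w (a - op x a) -> op_kernel w (a - iter n (op x) a).
Proof.
move=> aK; elim: n => [|n IH]; first by rewrite subrr; exact: op_kernel0.
rewrite iterS -[a - _](subrKA (op x a)); apply: op_kernelD => //.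
by rewrite -opNr -opDr; exact: op_kernel_op.
Qed.

(* Congruence to one's own image under a nilpotent operator forces membership. *)
Lemma op_kernel_nil w x a : op_kernel w (a - op x a) -> op_kernel w a.
Proof. by move=> aK; have [n an] := op_nil x a; have := op_kernel_iter n aK; rewrite an subr0. Qed.

(** The nontrivial direction is [op_kernel_nil] for [- x]; it is what makes the coset measure
    invariant under the action. *)
Lemma op_kernel_unipotent w x a : op_kernel w (a + op x a) <-> op_kernel w a.
Proof.
split=> [|aK]; first by rewrite -[op x a]opprK -opNl => /op_kernel_nil.
by apply: op_kernelD => //; exact: op_kernel_op.
Qed.

Lemma coset_haar_invariant w x z a :
  \int[coset_haar w]_v trig z (a + op x a) v = \int[coset_haar w]_v trig z a v.
Proof.
rewrite !coset_haar_trig; case: (asboolP (op_kernel w a)) => aK; case: asboolP => //.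
- by move=> _; rewrite /trig chiD aK mulr1.
- by move=> naK; case: naK; apply/op_kernel_unipotent.
- by move=> /op_kernel_unipotent.
Qed.

Lemma op_act_continuous x : continuous (op_act x).
Proof.
by apply: (@affine_continuous R A _ (fun=> 1) (fun a => a + op x a)) => w a; rewrite op_actE mul1r.
Qed.

Lemma trig_op_act x z a w : trig z a (op_act x w) = trig z (a + op x a) w.
Proof. by rewrite /trig op_actE. Qed.

Lemma coset_haar_op_act w x z a :
  \int[coset_haar w]_v trig z a (op_act x v) = \int[coset_haar w]_v trig z a v.
Proof.
rewrite -(coset_haar_invariant w x z a).
by congr Rintegral; apply/funext => v; exact: trig_op_act.
Qed.

Lemma coset_haar_preimage w x (B : set (borel X)) : measurable B ->
  coset_haar w (op_act x @^-1` B) = coset_haar w B.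
Proof.
apply: (transport_determined (@op_act_continuous x) countA) => z a.
exact: coset_haar_op_act.
Qed.

Lemma twist_continuous w x : continuous (twist w x).
Proof.
by apply: (@affine_continuous R A _ (fun a => w (op x a)) id) => v a; rewrite mulrC.
Qed.

Lemma coset_haar_twist w x (B : set (borel X)) : measurable B ->
  coset_haar w (twist w x @^-1` B) = coset_haar w B.
Proof.
apply: (transport_determined (@twist_continuous w x) countA) => z a.
have -> : (fun v => trig z a (twist w x v)) = trig (z * w (op x a)) a.
  by apply/funext => v; rewrite /trig /= mulrA mulrAC.
rewrite !coset_haar_trig; case: asboolP => // aK.
by rewrite aK mulr1.
Qed.

Fact reflectD w v (u : X) a b :
  w (a + b) * v (a + b) * u (- (a + b)) = w a * v a * u (- a) * (w b * v b * u (- b)).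
Proof. by rewrite opprD !chiD !mulrA; ring. Qed.

Fact reflect_norm1 w v (u : X) a : `|w a * v a * u (- a)| = 1.
Proof. by rewrite !normrM !chi_norm1 !mulr1. Qed.

(** The map u -> w v / u exchanges [w] and [v]. It converts approximation of [v] by orbit points
    into a statement about translates of [v] near [w]. *)
Definition reflect w v u : X := Character (reflectD w v u) (reflect_norm1 w v u).

Lemma chi_mulN w a : w a * w (- a) = 1.
Proof. by rewrite -chiD subrr chi0. Qed.

Lemma reflect_diag w v : reflect w v v = w.
Proof. by apply: character_eq => a /=; rewrite -mulrA chi_mulN mulr1. Qed.

Lemma reflect_op_act w v x : reflect w v (op_act x w) = twist w (- x) v.
Proof.
apply: character_eq => a /=; rewrite opNr opNl.
by rewrite [w a * v a]mulrC -mulrA [w a * _]mulrA chi_mulN mul1r.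
Qed.

(* Countably many translates of [U], all of the same measure, cover the orbit closure. *)
Lemma coset_haar_gt0 w (U : set X) : open U -> U w -> (0 < coset_haar w U)%E.
Proof.
move=> oU Uw; rewrite lt_neqAle measure_ge0 andbT; apply/eqP => U0.
have [e eA] := countable_enumeration countA.
pose V := \bigcup_n (twist w (- e n) @^-1` U).
have oV : open V.
  apply: bigcup_open => n _.
  by move/continuousP : (@twist_continuous w (- e n)); apply.
have V0 : coset_haar w V = 0%E.
  apply/eqP; rewrite eq_le measure_ge0 andbT.
  apply: (@le_trans _ _ (\sum_(0 <= k <oo) coset_haar w (twist w (- e k) @^-1` U))%E).
    apply: (measure_sigma_subadditive (R := R) (T := borel X)) => // [k|].
      apply: preimage_borel_measurable; first exact: twist_continuous.
      exact: sub_sigma_algebra.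
    exact: sub_sigma_algebra.
  rewrite eseries0// => k _ _.
  by rewrite coset_haar_twist//; exact: sub_sigma_algebra.
(* An orbit point [op_act x w] close enough to [v] is reflected into [U], and its reflection is
   [twist w (- x) v]. *)
have closV : closure (range (fun x => op_act x w)) `<=` V.
  move=> v; have Rv : nbhs v (reflect w v @^-1` U).
    apply: open_nbhs_nbhs; split; last by rewrite /= reflect_diag.
    have : continuous (reflect w v) by exact: (@affine_continuous R A _ (fun a => w a * v a) -%R).
    by move/continuousP; apply.
  move=> /(_ _ Rv)[_ [[x _ <-]]] /=; rewrite reflect_op_act => Ux.
  by have [n en] := eA x; exists n => //; rewrite /= en.
have N0 : coset_haar w (~` closure (range (fun x => op_act x w))) = 0%E.
  apply: coset_haar_null; first exact/closed_openC/closed_closure.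
  by move=> x; apply; apply: subset_closure; exists x.
have cover : V `|` ~` closure (range (fun x => op_act x w)) = setT.
  apply/seteqP; split=> // v _.
  by have [/closV Vv|] := pselect (closure (range (fun x => op_act x w)) v); [left|right].
have : (coset_haar w (V `|` ~` closure (range (fun x => op_act x w))) <=
    coset_haar w V + coset_haar w (~` closure (range (fun x => op_act x w))))%E.
  apply: measureU2; apply: sub_sigma_algebra => //.
  exact/closed_openC/closed_closure.
by rewrite V0 N0 adde0 cover probability_setT lee_fin ler10.
Qed.

(** * Zero-one law for the one-sided action *)

Section Ergodicity.
Variables (w : X) (B : set (borel X)).
Hypothesis mB : measurable B.
Hypothesis B_invariant : forall x, op_act x @^-1` B = B.

Let coef z a := \int[coset_haar w]_(v in B) trig z a v.

Let coef_invariant z a x : coef z (a + op x a) = coef z a.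
Proof.
rewrite /coef -(@Rintegral_invariant R A _ (@op_act_continuous x) _ B z a countA)//.
  by congr Rintegral; apply/funext => v; rewrite trig_op_act.
by move=> z' a'; exact: coset_haar_op_act.
Qed.

Let coefD z z' a : coef (z + z') a = coef z a + coef z' a.
Proof.
rewrite /coef -RintegralD//; try exact: trig_integrable.
by congr Rintegral; apply/funext => v; rewrite /trig mulrDl raddfD.
Qed.

(** Almost every [v] agrees with [w] at [b]: the open set where the real part of conj (w b) v(b) is
    below 1 misses the orbit, hence is null, and off it a number of modulus 1 with real part at
    least 1 equals 1. *)
Let coef_kernel z a b : op_kernel w b -> coef z (a + b) = coef (z * w b) a.
Proof.
move=> bK; rewrite /coef /Rintegral; congr fine; apply: ae_eq_integral => //.
- by apply/measurable_EFinP/measurable_funTS; exact: trig_measurable.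
- by apply/measurable_EFinP/measurable_funTS; exact: trig_measurable.
pose U : set X := [set v | trig (w b)^*%C b v < 1].
have oU : open U.
  have := @trig_continuous R A (w b)^*%C b.
  by move=> /continuousP /(_ [set y | y < 1]); apply; exact: open_lt.
have wb : w b * (w b)^*%C = 1 by rewrite -sqr_normc chi_norm1 expr1n.
exists U; split; first exact: sub_sigma_algebra.
  by apply: coset_haar_null => // x; rewrite /U /= /trig /= bK mulr1 mulrC wb /= ltxx.
move=> v /=; apply: contra_notP => vU Bv; congr EFin.
have vb : v b = w b.
  pose x := (w b)^*%C * v b.
  have x1 : `|x| = 1 by rewrite /x normrM normcJ !chi_norm1 mulr1.
  move/normc1_sqr : (x1) => ReIm.
  have Re1 : 1 <= complex.Re x by rewrite leNgt; apply/negP.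
  have Im0 : complex.Im x = 0.
    apply/eqP; rewrite -sqrf_eq0; apply/eqP; nra.
  have Ex : x = 1.
    apply/eqP; rewrite eq_complex /= Im0 eqxx andbT; apply/eqP.
    by rewrite Im0 in ReIm; nra.
  by rewrite -[v b]mul1r -wb -mulrA -/x Ex mulr1.
by rewrite /trig chiD vb mulrCA mulrC mulrAC.
Qed.

(* Bessel's inequality for the orthonormal functions [v |-> v (b i)] and the indicator of [B]. *)
Let coef_bessel z a n (b : nat -> A) :
  (forall i, coef z (b i) = coef z a) ->
  (forall i j, i != j -> ~ op_kernel w (b i - b j)) ->
  n%:R * coef z a ^+ 2 <= complex.Re (z * z^*%C).
Proof.
move=> bcoef bK.
pose sF := [seq (z, b i) | i <- iota 0 n].
pose sG := [seq (z * z^*%C, b i - b j) | i <- iota 0 n, j <- iota 0 n].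
have FE v : trigpoly sF v = complex.Re (\sum_(i <- iota 0 n) z * v (b i)).
  by rewrite /trigpoly big_map raddf_sum.
have GE v : trigpoly sG v =
    complex.Re ((\sum_(i <- iota 0 n) z * v (b i)) * (\sum_(i <- iota 0 n) z * v (b i))^*%C).
  rewrite /trigpoly big_allpairs_dep rmorph_sum/= big_distrl/= raddf_sum; apply: eq_bigr => i _.
  rewrite big_distrr/= raddf_sum; apply: eq_bigr => j _.
  by rewrite /trig /= chiD chiN rmorphM/=; congr (complex.Re _); rewrite mulrACA.
have F2G v : trigpoly sF v ^+ 2 <= trigpoly sG v.
  by rewrite FE GE; case: (\sum_(i <- _) _) => p q /=; nra.
have intF : \int[coset_haar w]_(v in B) trigpoly sF v = n%:R * coef z a.
  rewrite Rintegral_trigpoly// big_map (eq_bigr (fun=> coef z a)) => [|i _]; last exact: bcoef.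
  by rewrite big_const_seq count_predT size_iota iter_addr addr0 mulr_natl.
have intG : \int[coset_haar w]_v trigpoly sG v = n%:R * complex.Re (z * z^*%C).
  rewrite Rintegral_trigpoly// big_allpairs_dep (eq_big_seq (fun=> complex.Re (z * z^*%C))) => [|i iI].
    by rewrite big_const_seq count_predT size_iota iter_addr addr0 mulr_natl.
  rewrite (bigD1_seq i) ?iota_uniq//= big1 => [|j ji].
    rewrite coset_haar_trig subrr asboolT; first by rewrite addr0 /trig chi0 mulr1.
    exact: op_kernel0.
  by rewrite coset_haar_trig asboolF//; apply: bK; rewrite eq_sym.
(* With F and G for [trigpoly sF] and [trigpoly sG], integrate 2tF - t^2 <= F^2 <= G over [B], where
   F has integral [t]; as [B] has measure at most 1, t^2 is at most the full integral of G. *)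
pose t := n%:R * coef z a.
have h1 : 2 * t * (n%:R * coef z a) - t ^+ 2 <= n%:R * complex.Re (z * z^*%C).
  have fin2 : (\int[coset_haar w]_(v in B) (2 * t * trigpoly sF v - t ^+ 2) <=
      \int[coset_haar w]_(v in B) trigpoly sG v)%R.
    apply: le_Rintegral => // [||v _].
    - have [s ->] : is_trigpoly (fun v : X => 2 * t * trigpoly sF v - t ^+ 2).
        apply: is_trigpolyD; last exact: is_trigpolyC.
        by apply: is_trigpolyM; [exact: is_trigpolyC|exists sF].
      exact: trigpoly_integrable.
    - exact: trigpoly_integrable.
    - apply: le_trans (F2G v).
      by rewrite -subr_ge0 (_ : _ - _ = (trigpoly sF v - t) ^+ 2) ?sqr_ge0//; ring.
  have GB : \int[coset_haar w]_(v in B) trigpoly sG v <= \int[coset_haar w]_v trigpoly sG v.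
    rewrite /Rintegral fine_le//; try (apply: integrable_fin_num => //; exact: trigpoly_integrable).
    apply: ge0_subset_integral => //.
      by apply/measurable_EFinP; exact: trigpoly_measurable.
    by move=> v _; rewrite lee_fin (le_trans _ (F2G v))// sqr_ge0.
  have I2 : \int[coset_haar w]_(v in B) (2 * t * trigpoly sF v - t ^+ 2) =
      2 * t * (n%:R * coef z a) - t ^+ 2 * fine (coset_haar w B).
    rewrite RintegralB//.
    - by rewrite RintegralZl ?intF ?Rintegral_cst//; exact: trigpoly_integrable.
    - have [s ->] : is_trigpoly (fun v : X => 2 * t * trigpoly sF v).
        by apply: is_trigpolyM; [exact: is_trigpolyC|exists sF].
      exact: trigpoly_integrable.
    - have [s ->] : is_trigpoly (fun v : X => t ^+ 2) by exact: is_trigpolyC.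
      exact: trigpoly_integrable.
  have p1 : fine (coset_haar w B) <= 1.
    by rewrite -lee_fin fineK ?fin_num_measure//; exact: probability_le1.
  rewrite -intG; apply: (le_trans _ (le_trans fin2 GB)); rewrite I2 lerD2l lerN2.
  by rewrite ler_piMr// sqr_ge0.
have [->|n0] := eqVneq n 0%N.
  by rewrite mul0r; case: (z) => p q /=; rewrite mulrN opprK addr_ge0// -expr2 sqr_ge0.
have nn0 : 0 < n%:R :> R by rewrite ltr0n lt0n.
rewrite -(ler_pM2l nn0); apply: le_trans h1; rewrite /t.
by rewrite le_eqVlt; apply/orP; left; apply/eqP; ring.
Qed.

Let coef_notin z a : ~ op_kernel w a -> coef z a = 0.
Proof.
move=> aK.
(* In the first case a -> a + op x a preserves the coefficient and also multiplies its weight by w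
   (op x a), which is not 1. *)
have [[x [xK wx]]|H] := pselect (exists x, op_kernel w (op x a) /\ w (op x a) != 1).
  apply: (@additive_fixed R (coef ^~ a) (w (op x a))) => // z1.
  by rewrite -coef_kernel// coef_invariant.
have H1 x : op_kernel w (op x a) -> w (op x a) = 1.
  by move=> xK; apply/eqP; apply: contrapT => /negP wx; apply: H; exists x.
(* If every [op y (op x a)] were in the kernel, [H1] would give them the value 1, which puts
   [op x a] in the kernel. *)
have step x : exists y, ~ op_kernel w (op x a) -> ~ op_kernel w (op (mul y x) a).
  have [xK|xK] := pselect (op_kernel w (op x a)); first by exists 0.
  apply: contrapT => nex; apply: xK => y; rewrite op_mul; apply: H1.
  by apply: contrapT => yK; apply: nex; exists y.
have [Y YP] := choice step.
(* Now [op x a] leaves the kernel for some [x], and then the multiples [op y (op x a)]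
   that leave it form an infinite chain of pairwise inequivalent elements. *)
have [x0 x0K] : exists x, ~ op_kernel w (op x a).
  apply: contrapT => nex; apply: aK => x; apply: H1.
  by apply: contrapT => xK; apply: nex; exists x.
pose xs n := iter n (fun x => mul (Y x) x) x0.
have xsK n : ~ op_kernel w (op (xs n) a) by elim: n => // n IH; exact: YP.
have xs_mul i k : exists y, op (xs (i + k.+1)%N) a = op y (op (xs i) a).
  elim: k => [|k [y IH]]; first by rewrite addn1; exists (Y (xs i)); rewrite op_mul.
  by exists (mul (Y (xs (i + k.+1)%N)) y); rewrite addnS /= -op_mul IH -op_mul.
(* A later term is [op y] of an earlier one, so their congruence would put the earlier one in the
   kernel by [op_kernel_nil]. *)
have xs_sep i j : i != j -> ~ op_kernel w (op (xs i) a - op (xs j) a).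
  wlog ij : i j / (i < j)%N => [W|_].
    move=> ij; have := ij; rewrite neq_ltn => /orP[lt|lt]; first exact: W.
    by move=> /op_kernelN; rewrite opprB; apply: W => //; rewrite eq_sym.
  have [y E] := xs_mul i (j - i.+1)%N.
  by move: E; rewrite -addSnnS subnKC// => -> /op_kernel_nil; exact: xsK.
have bessel n : n%:R * coef z a ^+ 2 <= complex.Re (z * z^*%C).
  apply: (@coef_bessel z a n (fun i => a + op (xs i) a)) => [i|i j ij]; first exact: coef_invariant.
  by rewrite opprD addrACA subrr add0r; exact: xs_sep.
apply/eqP; rewrite -sqrf_eq0; apply/negPn/negP => c0.
have c2 : 0 < coef z a ^+ 2 by rewrite lt_neqAle eq_sym c0 sqr_ge0.
have := bessel (Num.truncn (complex.Re (z * z^*%C) / coef z a ^+ 2)).+1.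
by rewrite leNgt -ltr_pdivrMr// truncnS_gt.
Qed.

(** The coefficients over [B] are p times the full ones, so [B] meets every [C] in measure p m(C); C
    = B gives p = p^2. *)
Lemma coset_haar_ergodic : coset_haar w B = 0%E \/ coset_haar w B = 1%E.
Proof.
have fB : coset_haar w B \is a fin_num by exact: fin_num_measure.
pose p := fine (coset_haar w B).
have key z a : \int[coset_haar w]_(v in B) trig z a v = p * \int[coset_haar w]_(v in setT) trig z a v.
  rewrite coset_haar_trig; case: asboolP => aK; last by rewrite mulr0; exact: coef_notin.
  rewrite -[a]add0r [LHS]coef_kernel// add0r /coef.
  rewrite (_ : (fun v => trig _ 0 v) = cst (trig z a w)); last by apply/funext => v; rewrite /trig chi0 mulr1.
  by rewrite Rintegral_cst// mulrC.
have := trig_determines countA mB measurableT key mB; rewrite setIid setTI -/p => pp.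
have : p * (1 - p) = 0 by rewrite mulrBr mulr1 -pp subrr.
move=> /eqP; rewrite mulf_eq0 subr_eq0 => /orP[/eqP p0|/eqP p1]; [left|right].
  by rewrite -(fineK fB) -/p p0.
by rewrite -(fineK fB) -/p -p1.
Qed.

End Ergodicity.

End OneSided.

(** * Regularity *)

Section Regularity.
Variables (R : realType) (X : ptopologicalType) (m : probability (borel X) R).
Hypothesis X_compact : compact [set: X].
Hypothesis open_cozero : forall U : set X, open U ->
  exists2 f : nat -> X -> R, (forall n, continuous (f n)) & U = \bigcup_n [set x | 0 < f n x].

(** The sets with this property form a sigma-algebra containing the open sets; the symmetric form
    makes complements immediate. *)
Let approximable (B : set X) := forall e : R, 0 < e -> exists C U : set X,
  [/\ closed C, open U, C `<=` B, B `<=` U & (m (U `\` C) <= e%:E)%E].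

(** Continuity from above: it replaces a countable union of closed sets by a finite one, which is
    again closed. *)
Let remainder_small (U : set (borel X)) (C : (set (borel X))^nat) (d e : R) :
  measurable U -> (forall n, measurable (C n)) -> nondecreasing_seq C ->
  (m (U `\` \bigcup_n C n) <= d%:E)%E -> 0 < e -> exists N, (m (U `\` C N) <= (d + e)%:E)%E.
Proof.
move=> mU mC ndC Ud e0.
have UC : U `\` \bigcup_n C n = \bigcap_n (U `\` C n).
  by rewrite setDE setC_bigcup -bigcapIr//; exists 0%N.
have mUC n : measurable (U `\` C n) by exact: measurableD.
have : m \o (fun n => U `\` C n) @ \oo --> m (\bigcap_n (U `\` C n)).
  apply: nonincreasing_cvg_mu => //.
  - by rewrite -ge0_fin_numE//; exact: fin_num_measure.
  - exact: bigcapT_measurable.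
  - by move=> i j ij; apply/subsetPset; apply: setDS; apply/subsetPset; exact: ndC.
rewrite -UC -[X in _ --> X]fineK; last first.
  by apply: fin_num_measure; apply: measurableD => //; exact: bigcupT_measurable.
move=> /fine_cvgP[_] /cvgrPdist_lt /(_ e e0)[N _ /(_ N (leqnn N))] /= H.
exists N; rewrite -[leLHS]fineK ?fin_num_measure// lee_fin.
have : fine (m (U `\` \bigcup_n C n)) <= d.
  rewrite -lee_fin fineK//; apply: fin_num_measure; apply: measurableD => //.
  exact: bigcupT_measurable.
by move: H; rewrite ltr_distlC => /andP[_]; lra.
Qed.

Let approximable_bigcup (B : nat -> set X) :
  (forall n, approximable (B n)) -> approximable (\bigcup_n B n).
Proof.
(* Half of [e] is spread over the members of the union, half pays for the truncation to finitely
   many closed sets. *)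
move=> aB e e0; have e20 : 0 < e / 2 by rewrite divr_gt0.
have /choice[CU CUP] : forall n, exists CU : set X * set X,
    [/\ closed CU.1, open CU.2, CU.1 `<=` B n, B n `<=` CU.2 &
        (m (CU.2 `\` CU.1) <= (e / 2 / (2 ^ n.+1)%:R)%:E)%E].
  move=> n; have en : 0 < e / 2 / (2 ^ n.+1)%:R by rewrite divr_gt0// ltr0n expn_gt0.
  by have [C [U CU]] := aB n _ en; exists (C, U).
pose U := \bigcup_n (CU n).2; pose C N := \big[setU/set0]_(i < N) (CU i).1.
have CE N : C N = \bigcup_(i < N) (CU i).1 by rewrite bigcup_mkord.
have clC N : closed (C N) by apply: closed_bigsetU => i _; have [] := CUP i.
have oU : open U by apply: bigcup_open => n _; have [] := CUP n.
have dC n : (CU n).1 `<=` \bigcup_N C N.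
  by move=> x Cx; exists n.+1 => //; rewrite CE; exists n => /=.
have [|||||N UN] := @remainder_small U C (e / 2) (e / 2) => //.
- exact: open_borel_measurable.
- by move=> n; exact: closed_borel_measurable.
- move=> i j ij; apply/subsetPset; rewrite !CE => x [k /= ki Ck].
  by exists k => //=; exact: leq_trans ij.
- apply: (@le_trans _ _ (\sum_(0 <= n <oo) m ((CU n).2 `\` (CU n).1))%E).
    apply: (measure_sigma_subadditive (R := R) (T := borel X)) => [n||x [[n _ Ux] nC]].
    + by have [/closed_borel_measurable ? /open_borel_measurable ? _ _ _] := CUP n; exact: measurableD.
    + apply: measurableD; first exact: open_borel_measurable.
      by apply: bigcupT_measurable => n; exact: closed_borel_measurable.
    + by exists n => //; split=> // /dC.
  apply: (@le_trans _ _ (\sum_(0 <= n <oo) (e / 2 / (2 ^ n.+1)%:R)%:E)%E).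
    by apply: lee_nneseries => // n _; have [] := CUP n.
  have := @epsilon_trick R (fun=> 0%E) (e / 2) xpredT (fun=> lexx _) (ltW e20).
  rewrite [X in (_ <= X + _)%E]eseries0// add0e; apply: le_trans; rewrite le_eqVlt; apply/orP; left; apply/eqP.
  by apply: eq_eseriesr => n _; rewrite add0e.
exists (C N), U; split => //.
- move=> x; rewrite CE => -[i _ Cx]; exists i => //.
  by have [_ _ + _ _] := CUP i; exact.
- by move=> x [i _ Bx]; exists i => //; have [_ _ _ + _] := CUP i; exact.
- by rewrite [e]splitr.
Qed.

Let approximable_open (U : set X) : open U -> approximable U.
Proof.
move=> /open_cozero[f cf ->]; apply: approximable_bigcup => n e e0.
pose level k := [set x | k.+1%:R^-1 <= f n x].
have cl k : closed (level k).
  have /continuous_closedP : continuous (f n) by [].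
  by move=> /(_ [set y | k.+1%:R^-1 <= y]); apply; exact: closed_ge.
have oU : open [set x | 0 < f n x].
  by move/continuousP : (cf n) => /(_ [set y | 0 < y]); apply; exact: open_gt.
have [|||||N UN] := @remainder_small [set x | 0 < f n x] level 0 e => //.
- exact: open_borel_measurable.
- by move=> k; exact: closed_borel_measurable.
- move=> i j ij; apply/subsetPset => x; apply: le_trans.
  by rewrite lef_pV2 ?posrE// ler_nat ltnS.
- rewrite (_ : _ `\` _ = set0) ?measure0//; apply/seteqP; split=> // x [/= f0]; apply.
  have [k fk] := ltr_add_invr f0; exists k => //=.
  by move: fk; rewrite add0r => /ltW.
exists (level N), [set x | 0 < f n x]; split=> //; last by move: UN; rewrite add0r.
by move=> x /=; apply: lt_le_trans; rewrite invr_gt0.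
Qed.

Let approximable_borel (B : set (borel X)) : measurable B -> approximable B.
Proof.
apply: smallest_sub; last exact: approximable_open.
split=> [||]; last exact: approximable_bigcup.
- move=> e e0; exists set0, set0.
  by split=> //; [exact: closed0|exact: open0|rewrite setD0 measure0 lee_fin ltW].
- move=> C aC e /aC[F [U [cF oU FC CU FU]]]; exists (~` U), (~` F); split => //.
  + exact: open_closedC.
  + exact: closed_openC.
  + by rewrite setTD; exact: subsetC.
  + by rewrite setTD; exact: subsetC.
  + by rewrite setDE setCK setIC -setDE.
Qed.

Lemma compact_regular_measure : regular_measure m.
Proof.
move=> B mB; split; apply/eqP; rewrite eq_le; apply/andP; split.
- apply: le_ereal_inf_tmp => _ [U [oU BU] <-].
  by apply: le_measure => //; rewrite inE//; exact: open_borel_measurable.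
- apply/lee_addgt0Pr => e /(approximable_borel mB)[C [U [cC oU CB BU UC]]].
  apply: (@le_trans _ _ (m U)); first by apply: ereal_inf_lbound; exists U.
  have mC := closed_borel_measurable cC; have mU := open_borel_measurable oU.
  rewrite -(setDUK (subset_trans CB BU)).
  rewrite (le_trans (measureU2 _ _ _))//; first exact: measurableD.
  by apply: leeD => //; apply: le_measure => //; rewrite inE.
- apply/lee_addgt0Pr => e /(approximable_borel mB)[C [U [cC oU CB BU UC]]].
  have mC := closed_borel_measurable cC; have mU := open_borel_measurable oU.
  apply: (@le_trans _ _ (m U)); first by apply: le_measure => //; rewrite inE.
  rewrite -[X in m X](setDUK (subset_trans CB BU)).
  rewrite (le_trans (measureU2 _ _ _))//; first exact: measurableD.
  apply: leeD => //; apply: ereal_sup_ubound; exists C => //; split => //.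
  exact: (subclosed_compact cC X_compact).
- by apply: ge_ereal_sup => _ [C [_ mC CB] <-]; apply: le_measure => //; rewrite inE.
Qed.

End Regularity.

(** * The two-sided action *)

Section Mixture.
Variables (R : realType) (d d' : measure_display) (T : measurableType d) (Y : measurableType d').
Variables (l : probability T R) (k : T -> probability Y R).
Hypothesis k_measurable : forall B : set Y, measurable B -> measurable_fun [set: T] (fun t => k t B).

Definition mixture (B : set Y) : \bar R := (\int[l]_t k t B)%E.

Let mixture0 : mixture set0 = 0%E.
Proof. by rewrite /mixture (eq_integral (cst 0%E)) ?integral0// => t _; rewrite measure0. Qed.

Let mixture_ge0 B : (0 <= mixture B)%E.
Proof. by apply: integral_ge0 => t _; exact: measure_ge0. Qed.

Let mixture_additive : semi_sigma_additive mixture.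
Proof.
move=> F mF tF mUF; have -> : mixture (\bigcup_n F n) = (\sum_(n <oo) mixture (F n))%E.
  rewrite -(@integral_nneseries _ _ _ l setT measurableT (fun n t => k t (F n)))// => [|n];
    last exact: k_measurable.
  by apply: eq_integral => t _; rewrite measure_bigcup//; apply: eq_eseriesl => n; rewrite in_setT.
by apply: is_cvg_nneseries => n _ _; exact: mixture_ge0.
Qed.

HB.instance Definition _ := isMeasure.Build _ _ _ mixture mixture0 mixture_ge0 mixture_additive.

Let mixture_setT : mixture setT = 1%E.
Proof.
rewrite /mixture (eq_integral (cst 1%E)) => [|t _]; last exact: probability_setT.
by rewrite integral_cst//= probability_setT mule1.
Qed.

HB.instance Definition _ := Measure_isProbability.Build _ _ _ mixture mixture_setT.

Definition mixture_probability : probability Y R := mixture.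

End Mixture.

Section CharacterValues.
Variables (R : realType) (A : zmodType).
Local Notation X := (character R A).

Lemma trig1_eq1 a (w : X) : trig 1 a w = 1 <-> w a = 1.
Proof.
rewrite trig1; split=> [wa1|->//]; have /normc1_sqr := chi_norm1 w a.
by rewrite wa1; case: (w a) wa1 => p q /= -> pq; congr Complex; nra.
Qed.

Lemma closed_eq1 a : closed [set w : X | w a = 1].
Proof.
have /continuous_closedP/(_ [set 1]) c := @trig_continuous R A 1 a.
rewrite (_ : [set w | _] = trig 1 a @^-1` [set 1]); first by apply: c; exact: closed_eq.
by apply/seteqP; split=> w /= /trig1_eq1.
Qed.

End CharacterValues.

Section TwoSided.
Variables (R : realType) (K : fieldType) (A : nilAlgType K).
Hypothesis countA : countable [set: A].
Local Notation X := (character R A).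
Local Notation G := (algGroup A).
Implicit Types (x y a b : A) (g h : G) (w v : X) (B : set (borel X)).

(** Right multiplication composes in the opposite order, hence [mulr]; with it both sides are
    instances of the one-sided theory. *)
Let opr x a := nmul a x.
Let mulr x y := nmul y x.

Let nmul_nil x a : exists n, iter n (@nmul K A x) a = 0.
Proof.
(* [npow x n] has exponent n + 1, so n + 1 iterations are needed. *)
have [n /eqP xn] := nilpotent_elt x; exists n.+1.
have -> : iter n.+1 (nmul x) a = nmul (npow x n) a.
  by elim: n {xn} => // n IH; rewrite iterS IH nmulA.
by rewrite xn nmul0r.
Qed.

Let opr_nil x a : exists n, iter n (opr x) a = 0.
Proof.
have [n /eqP xn] := nilpotent_elt x; exists n.+1.
have -> : iter n.+1 (opr x) a = nmul a (npow x n).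
  by elim: n {xn} => // n IH; rewrite iterS IH /opr -nmulA npowSr.
by rewrite xn nmulr0.
Qed.

Let oprDl x y a : opr (x + y) a = opr x a + opr y a. Proof. exact: nmulDr. Qed.
Let oprDr x a b : opr x (a + b) = opr x a + opr x b. Proof. exact: nmulDl. Qed.
Let opr_mul x y a : opr x (opr y a) = opr (mulr x y) a. Proof. by rewrite /opr nmulA. Qed.
Let opl_mul x y a : nmul x (nmul y a) = nmul (nmul x y) a. Proof. exact: nmulA. Qed.
Let oplDl x y a : nmul (x + y) a = nmul x a + nmul y a. Proof. exact: nmulDl. Qed.
Let oplDr x a b : nmul x (a + b) = nmul x a + nmul x b. Proof. exact: nmulDr. Qed.

Let haar_l w : probability (borel X) R := coset_haar countA oplDl oplDr w.
Let haar_r w : probability (borel X) R := coset_haar countA oprDl oprDr w.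
Let act_l x w : X := op_act oplDr x w.
Let act_r x w : X := op_act oprDr x w.

Let dual_actE g h w : dual_act (g, h) w = act_l (minus1 g^-1%g) (act_r (minus1 h) w).
Proof. by apply: character_eq => a; rewrite /act_l /act_r !op_actE. Qed.

Let act_l_continuous x : continuous (act_l x). Proof. exact: op_act_continuous. Qed.

Let dual_act_continuous g h : continuous (@dual_act R K A (g, h)).
Proof.
apply: (@affine_continuous R A _ (fun=> 1) (fun a => ract (lact g^-1%g a) h)) => u a.
by rewrite mul1r.
Qed.

Let lact_mul g h a : lact g (lact h a) = lact (g * h)%g a.
Proof. by rewrite /lact /= nmulDr !nmulDl nmulA !addrA [LHS](ACl (1 * 3 * 2 * 4)). Qed.

Let ract_mul g h a : ract (ract a g) h = ract a (g * h)%g.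
Proof. by rewrite /ract /= nmulDl !nmulDr nmulA !addrA. Qed.

Let lact_ract g h a : lact g (ract a h) = ract (lact g a) h.
Proof. by rewrite /lact /ract !nmulDr !nmulDl nmulA addrACA. Qed.

Let dual_act_mul g h g' h' w :
  dual_act (g, h) (dual_act (g', h') w) = dual_act (g * g', h * h')%g w.
Proof.
apply: character_eq => a; rewrite /= /dual_act_fun /=.
by rewrite lact_ract ract_mul lact_mul invgM.
Qed.

Let dual_act1 w : dual_act (1%g : G, 1%g : G) w = w.
Proof.
apply: character_eq => a; rewrite /= /dual_act_fun /= invg1 /lact /ract /=.
by rewrite nmul0r addr0 nmulr0 addr0.
Qed.

Let dual_actK g h : cancel (@dual_act R K A (g, h)) (dual_act (g^-1, h^-1)%g).
Proof. by move=> w; rewrite dual_act_mul !mulVg dual_act1. Qed.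

Let dual_actVK g h : cancel (@dual_act R K A (g^-1, h^-1)%g) (dual_act (g, h)).
Proof. by move=> w; rewrite dual_act_mul !mulgV dual_act1. Qed.

Let image_dual_act g h B : dual_act (g, h) @` B = dual_act (g^-1, h^-1)%g @^-1` B.
Proof.
apply/seteqP; split=> [_ [w Bw <-]|w /= Bw]; first by rewrite /= dual_actK.
by exists (dual_act (g^-1, h^-1)%g w) => //; rewrite dual_actVK.
Qed.

Let act_lE x w : act_l x w = dual_act ((OnePlus x)^-1%g, 1%g : G) w.
Proof.
rewrite dual_actE invgK /=; congr act_l.
by apply: character_eq => a; rewrite /act_r op_actE /opr nmulr0 addr0.
Qed.

Let act_rE x w : act_r x w = dual_act (1%g : G, OnePlus x) w.
Proof.
rewrite dual_actE invg1 /=.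
by apply: character_eq => a; rewrite [RHS]op_actE nmul0r addr0.
Qed.

(** By associativity (a + xa)y = ay + x(ay): [a] is in the right kernel of the translate exactly
    when a + xa is in that of [w], so the coefficients agree. *)
Let haar_r_act_l x w B : measurable B -> haar_r (act_l x w) B = haar_r w (act_l x @^-1` B).
Proof.
move=> mB; apply/esym.
apply: (transport_determined (@act_l_continuous x) countA) mB => z a.
have -> : (fun v => trig z a (act_l x v)) = trig z (a + nmul x a).
  by apply/funext => v; rewrite /act_l trig_op_act.
rewrite !coset_haar_trig /act_l trig_op_act.
congr (if `[< _ >] then _ else _); apply/propext; rewrite /op_kernel /=.
by split=> H y; have := H y; rewrite /opr nmulDl chiD nmulA.
Qed.

Let haar_r_act_r x w B : measurable B -> haar_r w (act_r x @^-1` B) = haar_r w B.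
Proof. exact: (coset_haar_preimage countA oprDl oprDr opr_mul opr_nil). Qed.

Let haar_l_act_l x w B : measurable B -> haar_l w (act_l x @^-1` B) = haar_l w B.
Proof. exact: (coset_haar_preimage countA oplDl oplDr opl_mul nmul_nil). Qed.

(** As a function of [w], the coefficient at [a] is [trig z a] times the indicator of a closed set,
    an intersection of conditions w(ax) = 1. *)
Let haar_r_measurable B : measurable B -> measurable_fun [set: borel X] (fun w : borel X => haar_r w B).
Proof.
apply: (kernel_measurable countA) => z a.
pose Ka : set (borel X) := [set w | op_kernel opr w a].
rewrite (_ : (fun _ => _) = (fun w : borel X => trig z a w * \1_Ka w)); last first.
  apply/funext => w; rewrite coset_haar_trig indicE.
  by case: asboolP => wK; [rewrite mem_set// mulr1|rewrite memNset// mulr0].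
apply: measurable_funM; first exact: trig_measurable.
apply: measurable_indic; apply: closed_borel_measurable.
rewrite (_ : Ka = \bigcap_x [set w : X | w (opr x a) = 1]).
  by apply: closed_bigI => x _; exact: closed_eq1.
by apply/seteqP; split=> w H x; [move=> _|]; exact: H.
Qed.

Let orbit_haar w : probability (borel X) R := mixture_probability (haar_l w) haar_r_measurable.

Let act_l_measurable x B : measurable B -> measurable (act_l x @^-1` B : set (borel X)).
Proof. exact: preimage_borel_measurable (@act_l_continuous x) _. Qed.

Let orbit_haar_act_r x w B : measurable B -> orbit_haar w (act_r x @^-1` B) = orbit_haar w B.
Proof. by move=> mB; apply: eq_integral => v _; exact: haar_r_act_r. Qed.

(** The translation moves from the set to the index of the right Haar measure, where the invariance
    of [haar_l w] absorbs it. *)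
Let orbit_haar_act_l x w B : measurable B -> orbit_haar w (act_l x @^-1` B) = orbit_haar w B.
Proof.
move=> mB; transitivity (\int[haar_l w]_v haar_r (act_l x v) B)%E.
  by apply: eq_integral => v _; rewrite haar_r_act_l.
have mx : measurable_fun [set: borel X] (act_l x : borel X -> borel X).
  exact: transport_measurable (@act_l_continuous x).
rewrite -[LHS](@ge0_integral_pushforward _ _
  (borel X) (borel X) R (act_l x) mx (haar_l w) setT (fun v => haar_r v B))//.
- by apply: eq_measure_integral => C mC _; exact: haar_l_act_l.
- exact: haar_r_measurable.
Qed.

Let orbit_haar_preimage g h w B : measurable B ->
  orbit_haar w (dual_act (g, h) @^-1` B) = orbit_haar w B.
Proof.
move=> mB.
have -> : dual_act (g, h) @^-1` B = act_r (minus1 h) @^-1` (act_l (minus1 g^-1%g) @^-1` B).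
  by apply/seteqP; split=> v /=; rewrite dual_actE.
by rewrite orbit_haar_act_r ?orbit_haar_act_l//; exact: act_l_measurable.
Qed.

(** By the right zero-one law v -> haar_r v B is the indicator of a set [B1]. By [haar_r_act_l] this
    set is left invariant, so the left zero-one law decides its measure. *)
Let orbit_haar_ergodic w : ergodic_measure (@dual_act R K A) (orbit_haar w).
Proof.
move=> B mB invB.
have invB' g h : dual_act (g, h) @^-1` B = B.
  apply/seteqP; split=> v Bv; last by rewrite -(invB (g, h)); exists v.
  by move: Bv; rewrite /= -{1}(invB (g, h)) => -[u Bu /(can_inj (dual_actK g h)) <-].
have invr x : act_r x @^-1` B = B.
  by rewrite -[RHS](invB' 1%g (OnePlus x)); apply/seteqP; split=> v /=; rewrite act_rE.
have invl x : act_l x @^-1` B = B.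
  by rewrite -[RHS](invB' (OnePlus x)^-1%g 1%g); apply/seteqP; split=> v /=; rewrite act_lE.
have r01 v : haar_r v B = 0%E \/ haar_r v B = 1%E.
  exact: (coset_haar_ergodic countA oprDl opr_mul opr_nil v mB invr).
pose B1 : set (borel X) := [set v | haar_r v B = 1%E].
have mB1 : measurable B1.
  by have := haar_r_measurable mB measurableT (emeasurable_set1 1%E); rewrite setTI.
have invB1 x : act_l x @^-1` B1 = B1.
  by apply/seteqP; split=> v; rewrite /B1 /= haar_r_act_l// invl.
have -> : orbit_haar w B = haar_l w B1.
  transitivity (\int[haar_l w]_v (\1_B1 v)%:E)%E; last by rewrite integral_indic// setIT.
  apply: eq_integral => v _; rewrite indicE; have [v0|v1] := r01 v.
    by rewrite v0 memNset// /B1 /= v0 => /eqP; rewrite eqe eq_sym oner_eq0.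
  by rewrite v1 mem_set.
exact: (coset_haar_ergodic countA oplDl opl_mul nmul_nil w mB1 invB1).
Qed.

(** If the average vanished, haar_r v U would be 0 for almost every [v]; but it is positive for
    every [v] in [U], a set of positive left Haar measure. *)
Let orbit_haar_gt0 w (U : set X) : open U -> U w -> (0 < orbit_haar w U)%E.
Proof.
move=> oU Uw; rewrite lt_neqAle measure_ge0 andbT; apply/eqP => /esym U0.
have mU := open_borel_measurable oU.
have : (\int[haar_l w]_v `|haar_r v U|)%E = 0%E.
  by rewrite -[RHS]U0; apply: eq_integral => v _; rewrite gee0_abs.
move=> /(ae_eq_integral_abs _ measurableT (haar_r_measurable mU)).1 [N [mN N0 NE]].
have UN : U `<=` N.
  move=> v Uv; apply: NE => /= /(_ I) /eqP; apply/negP; rewrite gt_eqF//.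
  exact: (coset_haar_gt0 countA oprDl oprDr oU).
have : (0 < haar_l w U)%E by exact: (coset_haar_gt0 countA oplDl oplDr oU).
by rewrite ltNge -N0 le_measure// inE.
Qed.

Let orbit_closure_act g h w v :
  closure (act_orbit (@dual_act R K A) w) v -> closure (act_orbit (@dual_act R K A) w) (dual_act (g, h) v).
Proof.
move=> wv U /= nU.
have [_ [[[g' h'] _ <-] Us]] := wv _ (@dual_act_continuous g h v _ nU).
by exists (dual_act (g * g', h * h')%g w); split; [exists (g * g', h * h')%g|rewrite -dual_act_mul].
Qed.

(** The orbit closure [C] is stable under both actions: [haar_l w] is carried by [C], and so is
    [haar_r v] for each [v] in [C]. *)
Let orbit_haar_null w : orbit_haar w (~` closure (act_orbit (@dual_act R K A) w)) = 0%E.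
Proof.
set C := closure _.
have oC : open (~` C) by exact/closed_openC/closed_closure.
have mC := open_borel_measurable oC.
have Cw : C w by apply: subset_closure; exists (1%g, 1%g).
have rC v : C v -> haar_r v (~` C) = 0%E.
  move=> Cv; apply: coset_haar_null => // x; apply.
  by rewrite -/(act_r x v) act_rE; exact: orbit_closure_act.
have lC : haar_l w (~` C) = 0%E.
  apply: coset_haar_null => // x; apply.
  by rewrite -/(act_l x w) act_lE; exact: orbit_closure_act.
apply/eqP; rewrite eq_le measure_ge0 andbT -lC -[X in haar_l w X]setIT -integral_indic//.
apply: ge0_le_integral => //.
- exact: haar_r_measurable.
- by apply/measurable_EFinP; exact: measurable_indic.
- move=> v _; rewrite indicE; have [Cv|nCv] := pselect (C v); first by rewrite rC.
  by rewrite mem_set// probability_le1.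
Qed.

(** Positivity is known at the base point only. A neighbourhood of a point of the closure contains
    an orbit point, and invariance pulls it back to a neighbourhood of [w]. *)
Let orbit_haar_support w : msupport (orbit_haar w) = closure (act_orbit (@dual_act R K A) w).
Proof.
apply/seteqP; split=> v.
  move=> sv; apply: contrapT => nv.
  have oC : open (~` closure (act_orbit (@dual_act R K A) w)) by exact/closed_openC/closed_closure.
  by have := sv _ oC nv; rewrite orbit_haar_null ltxx.
move=> Cv U oU Uv; have [_ [[[g h] _ <-] Ugh]] := Cv U (open_nbhs_nbhs (conj oU Uv)).
rewrite -(orbit_haar_preimage g h); last exact: open_borel_measurable.
apply: orbit_haar_gt0 => //.
by move/continuousP : (@dual_act_continuous g h); apply.
Qed.

Lemma orbit_closure_ergodic_measure w : exists mu : probability (borel X) R,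
  [/\ regular_measure mu,
      invariant_measure (@dual_act R K A) mu,
      ergodic_measure (@dual_act R K A) mu &
      msupport mu = closure (act_orbit (@dual_act R K A) w)].
Proof.
exists (orbit_haar w); split.
- by apply: compact_regular_measure; [exact: character_compact|exact: open_cozero].
- by move=> [g h] B mB; rewrite image_dual_act orbit_haar_preimage.
- exact: orbit_haar_ergodic.
- exact: orbit_haar_support.
Qed.

End TwoSided.

Theorem proposition2p7 (R : realType) (K : fieldType) (A : nilAlgType K)
    (countK : countable [set: K]) (countA : countable [set: A])
    (amenG : amenable R (algGroup A)) (theta : character R A) :
  exists mu : probability (borel (character R A)) R,
    [/\ regular_measure mu,
        invariant_measure (@dual_act R K A) mu,
        ergodic_measure (@dual_act R K A) mu &
        msupport mu = closure (act_orbit (@dual_act R K A) theta)].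
Proof. exact: orbit_closure_ergodic_measure. Qed.
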